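(* Let $b\ge 2$ be an integer and let $f:[0,1]\to\mathbb{R}$ be differentiable with derivative $f'$ Lipschitz continuous of order $\beta$ for some $\beta\in(0,1]$, i.e. there is $C\ge 0$ with $|f'(x)-f'(y)|\le C|x-y|^{\beta}$ for all $x,y\in[0,1]$. Define \[ I(f):=\int_0^1 f(x)\,dx,\qquad \sigma^2(f):=\frac{1}{12}\int_0^1 (f'(x))^2\,dx . \] For $N=b^m$ with $m\in\mathbb{N}$, let \[ Q_N=\frac1N\sum_{i=0}^{N-1} f(X_{N,i}), \] where $X_{N,0},\dots,X_{N,N-1}$ are independent and $X_{N,i}$ is uniformly distributed on $[i/N,(i+1)/N]$ (this is the estimator of base $b$ fully nested scrambling of a one-dimensional $(0,m,1)$-net). For $r\in\mathbb{N}$ let $Q_N^{(1)},\dots,Q_N^{(r)}$ be independent copies of $Q_N$ and let $M_N^{(r)}:=\operatorname{median}(Q_N^{(1)},\dots,Q_N^{(r)})$. Then \[ \sqrt{r}\,N^{3/2}\bigl(M_N^{(r)}-I(f)\bigr)\xrightarrow{d}\mathcal{N}\!\left(0,\frac{\pi\,\sigma^2(f)}{2}\right)\qquad (N\to\infty\text{ and then } r\to\infty). \] That is, for every fixed $r$ the random variables $\sqrt{r}\,N^{3/2}(M_N^{(r)}-I(f))$ converge in distribution, as $N=b^m\to\infty$, to some random variable $Y_r$, and $Y_r$ converges in distribution to $\mathcal{N}(0,\pi\sigma^2(f)/2)$ as $r\to\infty$.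
   Context: The symbol $\xrightarrow{d}$ denotes convergence in distribution, and $\mathcal{N}(0,s^2)$ is the normal distribution with mean $0$ and variance $s^2$ (the point mass at $0$ if $s=0$). The median of $r$ real numbers is the usual sample median: the middle order statistic if $r$ is odd, and the average of the two middle order statistics if $r$ is even. The limit is an iterated one: first $N=b^m\to\infty$ (i.e. $m\to\infty$, with the integer base $b\ge2$ fixed) with $r$ fixed, and then $r\to\infty$. *)

(* Defs.v *)
From HB Require Import structures.
From mathcomp Require Import all_boot all_order all_algebra.
From mathcomp Require Import all_classical all_reals all_analysis.
From mathcomp Require Import measurable_realfun.

Set Implicit Arguments.
Unset Strict Implicit.
Unset Printing Implicit Defensive.

Import Order.TTheory GRing.Theory Num.Theory.
Import numFieldNormedType.Exports.

Local Open Scope classical_set_scope.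
Local Open Scope ring_scope.

(* Derivative relative to A: the difference quotient at x only sees points of
   A, so that on `[0, 1] the endpoint derivatives are the one-sided ones. *)
Definition has_derivative_on {R : realType} (A : set R) (f f' : R -> R) :=
  forall x, A x ->
    (f y - f x) / (y - x) @[y --> within A x^'] --> f' x.

Definition holder_on {R : realType} (A : set R) (g : R -> R) (C beta : R) :=
  forall x y, A x -> A y -> `|g x - g y| <= C * `|x - y| `^ beta.

Section probability_notions.
Context {R : realType}.

(* Laws are compared on measurable sets only: outside the sigma-algebra the
   values of a measure carry no information. *)
Definition uniformly_distributed d (T : measurableType d) (P : probability T R)
    (X : {RV P >-> R}) (a b : R) :=
  exists ab : a < b, forall A : set R, measurable A ->
    distribution P X A = uniform_prob ab A.

Definition mutually_independent d (T : measurableType d) (P : probability T R)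
    (I : finType) (X : I -> {RV P >-> R}) :=
  forall (J : {set I}) (A : I -> set R), (forall i, measurable (A i)) ->
    P (\bigcap_(i in [set` J]) X i @^-1` A i)
    = (\prod_(i in J) P (X i @^-1` A i))%E.

(* normal_prob 0 0 is by convention the uniform law on `[0, 1], hence the
   separate treatment of the degenerate case. *)
Definition centered_normal (v : R) : set R -> \bar R :=
  if v == 0 then \d_(0 : R) else normal_prob 0 (Num.sqrt v).

(* The X n may live on different probability spaces.  The limit law nu is passed
   as a bare set function because the library's laws on R are measures for two
   different (though extensionally equal) measurable structures on R:
   g_sigma_algebraType for normal_prob, R itself for distribution. *)
Definition cvg_in_distribution (d : nat -> measure_display)
    (T : forall n, measurableType (d n)) (P : forall n, probability (T n) R)
    (X : forall n, {RV (P n) >-> R}) (nu : set R -> \bar R) :=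
  forall x : R, {for x, continuous (fun t : R => nu `]-oo, t]%classic)} ->
    cdf (X n) x @[n --> \oo] --> nu `]-oo, x]%classic.

End probability_notions.

Arguments uniformly_distributed {R d T} P X a b.
Arguments mutually_independent {R d T} P {I} X.
Arguments cvg_in_distribution {R d T} P X nu.

Section median.
Context {R : realType}.

Definition median (s : seq R) : R :=
  let t := sort <=%R s in let n := size s in
  if odd n then t`_(n./2) else (t`_((n./2).-1) + t`_(n./2)) / 2.

Lemma le_nth_sort (s : seq R) k x : (k < size s)%N ->
  ((sort <=%R s)`_k <= x) = (k < count (fun y => (y <= x)%R) s)%N.
Proof.
move=> ks; have ss : sorted <=%R (sort <=%R s) by exact: sort_le_sorted.
have cE : count (fun y => (y <= x)%R) (sort <=%R s) = count (fun y => y <= x) s.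
  by apply/permP; rewrite perm_sort.
case: (ltnP k) => [kc|ck].
  by apply: (nth_count_le 0 ss); rewrite cE.
apply/negbTE; rewrite -ltNge; apply: (nth_count_gt 0 ss).
by rewrite cE size_sort ck.
Qed.

Context d (T : measurableType d).

Lemma measurable_count_le (fs : seq (T -> R)) (x : R) :
  (forall i, (i < size fs)%N -> measurable_fun setT (nth (cst 0) fs i)) ->
  forall k, measurable [set w | (k < count (fun y => (y <= x)%R)
                                     [seq f w | f <- fs])%N].
Proof.
elim: fs => [_ k|f fs IH mfs k] /=.
  by rewrite [X in measurable X](_ : _ = set0)//; apply/seteqP; split.
have {}IH := IH (fun i => mfs i.+1).
have mf : measurable (f @^-1` `]-oo, x]).
  by rewrite -[X in measurable X]setTI; exact: (mfs 0%N isT).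
case: k => [|k].
  rewrite [X in measurable X](_ : _ = f @^-1` `]-oo, x] `|`
    [set w | (0 < count (fun y => (y <= x)%R) [seq f w | f <- fs])%N]).
    by apply: measurableU => //; exact: IH.
  apply/seteqP; split => w /=; rewrite in_itv/=.
    by case: (f w <= x) => /= h; [left|right].
  by case: (f w <= x) => //= -[].
set c := fun w => count (fun y => (y <= x)%R) [seq f w | f <- fs].
rewrite [X in measurable X](_ : _ =
    (f @^-1` `]-oo, x] `&` [set w | (k < c w)%N])
    `|` [set w | (k.+1 < c w)%N]).
  by apply: measurableU; [apply: measurableI => //|]; exact: IH.
apply/seteqP; split => w /=; rewrite in_itv/= -/(c w).
  by case: (f w <= x) => /= h; [left|right].
by case: (f w <= x) => /= [] [[]|] // /ltnW.
Qed.

Lemma measurable_nth_sort (fs : seq (T -> R)) k :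
  (forall i, (i < size fs)%N -> measurable_fun setT (nth (cst 0) fs i)) ->
  measurable_fun setT (fun w => (sort <=%R [seq f w | f <- fs])`_k).
Proof.
move=> mfs; have [ks|sk] := ltnP k (size fs); last first.
  rewrite (_ : (fun _ => _) = cst 0)//; apply/funext => w/=.
  by rewrite nth_default// size_sort size_map.
apply: (measurability _ (RGenOInfty.measurableE R)) => //= _ [_ [x ->] <-].
rewrite setTI (_ : _ @^-1` _ = ~` [set w | (k < count (fun y => (y <= x)%R)
                                     [seq f w | f <- fs])%N]).
  by apply: measurableC; exact: measurable_count_le.
apply/seteqP; split => w /=; rewrite in_itv/= andbT -le_nth_sort ?size_map//.
  by rewrite ltNge => /negP.
by rewrite ltNge => /negP.
Qed.

End median.

(* Pointwise median of r real random variables, as a random variable. *)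
Section median_rv.
Context {R : realType} d (T : measurableType d).
Context (r : nat) (X : 'I_r -> {mfun T >-> R}).

Definition median_rv (w : T) : R := median [seq X i w | i <- enum 'I_r].

Let measurable_median_rv : measurable_fun setT median_rv.
Proof.
pose fs : seq (T -> R) := [seq (X i : T -> R) | i <- enum 'I_r].
have fsE w : [seq X i w | i <- enum 'I_r] = [seq f w | f <- fs].
  by rewrite /fs -[RHS]map_comp.
have mfs i : (i < size fs)%N -> measurable_fun setT (nth (cst 0) fs i).
  rewrite size_map => ir; have ir' := ir; rewrite size_enum_ord in ir'.
  by rewrite (nth_map (Ordinal ir')).
pose t w := sort <=%R [seq f w | f <- fs]; pose n := size fs.
have -> : median_rv = fun w =>
    if odd n then (t w)`_(n./2) else ((t w)`_((n./2).-1) + (t w)`_(n./2)) / 2.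
  by apply/funext => w; rewrite /median_rv /median fsE size_map.
case: (odd n); first exact: measurable_nth_sort.
by apply: measurable_funM => //; apply: measurable_funD;
  exact: measurable_nth_sort.
Qed.

HB.instance Definition _ :=
  isMeasurableFun.Build _ _ _ _ median_rv measurable_median_rv.

End median_rv.

Section rescaled_rv.
Context {R : realType} d (T : measurableType d).
Context (a c : R) (X : {mfun T >-> R}).

Definition rescaled_rv (w : T) : R := a * (X w - c).

Let measurable_rescaled_rv : measurable_fun setT rescaled_rv.
Proof. by apply: measurable_funM => //; exact: measurable_funB. Qed.

HB.instance Definition _ :=
  isMeasurableFun.Build _ _ _ _ rescaled_rv measurable_rescaled_rv.

End rescaled_rv.

Section quadrature.
Context {R : realType}.

Definition integral01 (f : R -> R) : R :=
  \int[lebesgue_measure]_(x in `[0, 1]) f x.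

Definition sigma2 (f' : R -> R) : R := 12^-1 * integral01 (fun x => f' x ^+ 2).

(* N^-1 * \sum_i f (X i).  The integrand is cut off outside `[0, 1], because
   only its values there are meaningful, while the X i are only almost surely
   in `[0, 1]. *)
Definition quadrature (f : R -> R) d (T : measurableType d) (N : nat)
    (X : 'I_N -> T -> R) (w : T) : R :=
  N%:R^-1 * \sum_(i < N) (f \_ `[0, 1]) (X i w).

End quadrature.

(* Main.v *)
Require Import Defs.
From HB Require Import structures.
From mathcomp Require Import all_boot all_order all_algebra.
From mathcomp Require Import all_classical all_reals all_analysis.
From mathcomp Require Import measurable_realfun ring lra.

(** Write [N = b ^ m], [I] for the integral and [g] for [f] cut off outside the unit
    interval.

    Fluctuations of one estimator.  Strata of equal length have means that
    average to [I], so [N ^ (3 / 2) * (Q_N - I)] is the sum of the independent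
    centred variables [sqrt N * (g (X i) - E (g (X i)))].  On a stratum of length
    [l = 1 / N] starting at [a], the integrand is within [C * l ^ (1 + beta)] of an
    affine function of slope [f' a], hence [g (X i)] has variance
    [f' a ^ 2 * l ^ 2 / 12 + O (l ^ (2 + beta))] and deviates from its mean by
    [O (l)].  After normalization the variances form a Riemann sum for [sigma2 f']
    ([sum_variance_sigma2]) and the third moments sum to [O (1 / sqrt N)]
    ([sum_lyapunov_le]), so a central limit theorem applies ([quadrature_clt]).

    The central limit theorem ([lyapunov_clt]) is proved by Lindeberg replacement
    with the test functions [gauss_cdf ((a - s) / sqrt t)].  They solve the heat
    equation in [(s, t)], so trading an independent centred summand [Z] of variance
    [v] for an increase of [t] by [v] costs only [O (E |Z| ^ 3 + v ^ 2)]
    ([heat_step]), and no normal variable has to be introduced.  They are also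
    smoothed indicators of half-lines, from which distribution functions are
    recovered by letting [t] tend to 0.

    Fixed [r].  The median commutes with increasing affine maps, so the rescaled
    median is the median of [r] independent variables, each converging in law to
    a normal law of variance [r * sigma2 f'].  The probability that independent
    variables fall in a box of a grid is a product of increments of distribution
    functions; covering the event that the median is at most [x] by such boxes
    shows that the median converges in law as well ([median_rv_cvg]).  So [Y r]
    may be taken to be the median of [r] independent normal variables of variance
    [r * sigma2 f'], built on a product space ([iid_family_exists]).

    [r] tends to infinity.  The median is at most [x] when at least half of the
    values are.  If [sigma2 f'] is positive, one value is at most [x] with
    probability [1 / 2 + normal_pdf 0 1 0 * x / sqrt (r * sigma2 f')] to first
    order, and the central limit theorem for the number of such values, of
    variance about [r / 4], gives the limit variance
    [1 / (4 * normal_pdf 0 1 0 ^ 2) * sigma2 f' = pi * sigma2 f' / 2]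
    ([median_normal_cvg]).  If [sigma2 f'] is 0, every [Y r] is 0 almost surely
    ([median_point_mass]). *)

Set Implicit Arguments.
Unset Strict Implicit.
Unset Printing Implicit Defensive.

Import Order.TTheory GRing.Theory Num.Theory.
Import numFieldNormedType.Exports.

Local Open Scope classical_set_scope.
Local Open Scope ring_scope.

(** * The standard normal distribution function *)

(** Locked, so that conversion never unfolds the integral. *)
HB.lock Definition gauss_cdf {R : realType} (x : R) : R :=
  \int[lebesgue_measure]_(y in `]-oo, x]) normal_pdf 0 1 y.
Canonical gauss_cdf_unlockable := Unlockable gauss_cdf.unlock.

Section gauss.
Context {R : realType}.
Implicit Types x y z t v h : R.

Lemma derive_continuous (f f' : R -> R) x :
  is_derive x 1 f (f' x) -> {for x, continuous f}.
Proof.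
by move=> h; apply/differentiable_continuous/derivable1_diffP.
Qed.

Lemma is_derive_congr (f g : R -> R) x df dg :
  is_derive x 1 f df -> f =1 g -> df = dg -> is_derive x 1 g dg.
Proof. by move=> + /funext <- <-. Qed.

Lemma mean_value_bound (f f' : R -> R) (a b M : R) :
  (forall x, Num.min a b <= x <= Num.max a b -> is_derive x 1 f (f' x)) ->
  (forall x, Num.min a b <= x <= Num.max a b -> `|f' x| <= M) ->
  `|f b - f a| <= M * `|b - a|.
Proof.
wlog ab : a b / a <= b.
  move=> H df bf; case/orP: (le_total a b) => ab; first exact: H.
  by rewrite distrC [X in _ * X]distrC; apply: H => // x; rewrite minC maxC;
    [exact: df|exact: bf].
rewrite min_l// max_r// => df bf.
have [x||c] := @MVT_segment R f f' a b ab.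
- by rewrite in_itv/= => /andP[ax xb]; apply: df; rewrite !ltW.
- apply: continuous_in_subspaceT => x; rewrite inE/= in_itv/= => xab.
  exact/derive_continuous/df.
by rewrite in_itv/= => cab ->; rewrite normrM ler_wpM2r// bf.
Qed.

Lemma between_dist x h y :
  Num.min x (x + h) <= y <= Num.max x (x + h) -> `|y - x| <= `|h|.
Proof.
case/orP: (le_total 0 h) => h0.
  rewrite min_l ?lerDl// max_r ?lerDl// => /andP[h1 h2].
  by rewrite !ger0_norm ?subr_ge0// lerBlDl.
rewrite min_r ?gerDl// max_l ?gerDl// => /andP[h1 h2].
by rewrite !ler0_norm ?subr_le0// lerN2 lerBrDl.
Qed.

(** The induction step shared by the Taylor bounds: integrating a bound on the
    derivative raises its order in [h] by one. *)
Lemma bound_from_derive (g g' : R -> R) (h M : R) (n : nat) : 0 <= M ->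
  g 0 = 0 ->
  (forall x, Num.min 0 h <= x <= Num.max 0 h -> is_derive x 1 g (g' x)) ->
  (forall x, Num.min 0 h <= x <= Num.max 0 h -> `|g' x| <= M * `|x| ^+ n) ->
  `|g h| <= M * `|h| ^+ n.+1.
Proof.
move=> M0 g0 dg bg.
have : `|g h - g 0| <= M * `|h| ^+ n * `|h - 0|; last first.
  by rewrite g0 !subr0 -mulrA -exprSr.
apply: (mean_value_bound dg) => x xh.
rewrite (le_trans (bg _ xh))// ler_wpM2l// lerXn2r ?nnegrE//.
by have := @between_dist 0 h x; rewrite add0r subr0; apply.
Qed.

(** The hypotheses are local because this is applied to functions of the time
    variable, which are smooth only away from 0. *)
Lemma taylor2_bound (f f' f'' : R -> R) (x h M : R) : 0 <= M ->
  (forall y, Num.min x (x + h) <= y <= Num.max x (x + h) ->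
     is_derive y 1 f (f' y) /\ is_derive y 1 f' (f'' y) /\ `|f'' y| <= M) ->
  `|f (x + h) - f x - f' x * h| <= M * `|h| ^+ 2.
Proof.
move=> M0 df.
pose g k := f (x + k) - f x - f' x * k.
pose g' k := f' (x + k) - f' x.
have sub k y : Num.min 0 h <= k <= Num.max 0 h ->
    Num.min x (x + k) <= y <= Num.max x (x + k) ->
    Num.min x (x + h) <= y <= Num.max x (x + h).
  case/orP: (le_total 0 h) => h0.
    rewrite min_l// max_r// => /andP[k0 kh]; rewrite !min_l ?lerDl// !max_r ?lerDl//; lra.
  rewrite min_r// max_l// => /andP[k0 kh]; rewrite !min_r ?gerDl// !max_l ?gerDl//; lra.
have mid k : Num.min 0 h <= k <= Num.max 0 h ->
    Num.min x (x + h) <= x + k <= Num.max x (x + h).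
  by move=> /sub; apply; rewrite ge_min le_max lexx !orbT.
apply: (@bound_from_derive g g') => //.
- by rewrite /g addr0 subrr mulr0 subr0.
- move=> k kh; have [dk _] := df (x + k) (mid _ kh).
  have dxk : is_derive k 1 (fun k => x + k : R) 1.
    have := is_deriveD (is_derive_cst x k 1) (is_derive_id k (1 : R)).
    by rewrite add0r.
  have dfk : is_derive k 1 (fun k => f (x + k)) (f' (x + k)).
    have := @is_derive1_comp _ f (fun k => x + k) k _ _ dk dxk.
    by rewrite mulr1.
  have := is_deriveB (is_deriveB dfk (is_derive_cst (f x) k 1)) (is_deriveZ (f' x) (is_derive_id k (1 : R))).
  by rewrite subr0 scaler1.
- move=> k kh.
  have -> : `|k| ^+ 1 = `|x + k - x| by rewrite addrAC subrr add0r expr1.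
  by apply: (@mean_value_bound f' f'') => y /(sub _ _ kh) /df[_ []].
Qed.

Lemma taylor3_bound (f f' f'' f3 : R -> R) (x h M : R) : 0 <= M ->
  (forall y, is_derive y 1 f (f' y)) ->
  (forall y, is_derive y 1 f' (f'' y)) ->
  (forall y, is_derive y 1 f'' (f3 y)) ->
  (forall y, `|f3 y| <= M) ->
  `|f (x + h) - f x - f' x * h - 2^-1 * f'' x * h ^+ 2| <= M * `|h| ^+ 3.
Proof.
move=> M0 df df' df'' bf.
pose g k := f (x + k) - f x - f' x * k - 2^-1 * f'' x * k ^+ 2.
pose g' k := f' (x + k) - f' x - f'' x * k.
apply: (@bound_from_derive g g') => //.
- by rewrite /g addr0 subrr expr0n/= !mulr0 !subr0.
- move=> k kh.
  have dxk : is_derive k 1 (fun k => x + k : R) 1.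
    have := is_deriveD (is_derive_cst x k 1) (is_derive_id k (1 : R)).
    by rewrite add0r.
  have dfk : is_derive k 1 (fun k => f (x + k)) (f' (x + k)).
    have := @is_derive1_comp _ f (fun k => x + k) k _ _ (df _) dxk.
    by rewrite mulr1.
  have := is_deriveB (is_deriveB (is_deriveB dfk (is_derive_cst (f x) k 1))
    (is_deriveZ (f' x) (is_derive_id k (1 : R))))
    (is_deriveZ (2^-1 * f'' x) (is_deriveX 2 (is_derive_id k (1 : R)))).
  move=> H; apply: (is_derive_congr H) => [y|].
    by rewrite /g !fctE.
  by rewrite /g' /GRing.scale/= expr1; field.
- move=> k kh; by apply: (@taylor2_bound f' f'' f3) => // y _; split.
Qed.

Lemma normal_pdf01E x : normal_pdf 0 1 x = normal_peak 1 * expR (- (x ^+ 2 / 2)).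
Proof.
rewrite normal_pdfE ?oner_neq0// /normal_fun; congr (_ * expR _).
by rewrite subr0 expr1n mulNr.
Qed.

Lemma is_derive_normal_pdf x : is_derive x 1 (normal_pdf 0 1) (- (x * normal_pdf 0 1 x)).
Proof.
have -> : normal_pdf 0 1 = fun x : R => normal_peak 1 * expR (- (x ^+ 2 / 2)).
  by apply/funext => y; rewrite normal_pdf01E.
have H1 := is_deriveN (is_deriveZ (2^-1) (is_deriveX 2 (is_derive_id x (1 : R)))).
have H2 := is_deriveZ (normal_peak 1) (@is_derive1_comp _ expR _ x _ _ (is_derive_expR _) H1).
apply: (is_derive_congr H2) => [y|]; rewrite /GRing.scale/= ?fctE /GRing.scale/=.
  by rewrite [y ^+ 2 / 2]mulrC.
by rewrite expr1 [x ^+ 2 / 2]mulrC; field.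
Qed.

Lemma is_derive_gauss_cdf x : is_derive x 1 gauss_cdf (normal_pdf 0 1 x).
Proof.
rewrite unlock.
have xu : x < x + 1 by rewrite ltrDl.
have fi : lebesgue_measure.-integrable [set` Interval -oo%O (BRight (x + 1))] (EFin \o normal_pdf 0 1).
  by apply: (integrableS _ _ (subsetT _)) => //; exact: integrable_normal_pdf.
have [d1 d2] := continuous_FTC1 xu fi (ltNyr _) (@continuous_normal_pdf R 0 1 (oner_neq0 _) x).
by have := derivableP d1; rewrite -derive1E d2.
Qed.

Lemma derivable_cvg_continuous (f f' : R -> R) :
  (forall x, is_derive x 1 f (f' x)) -> continuous f.
Proof. by move=> df x; exact: derive_continuous (df x). Qed.

Lemma continuous_gauss_cdf : continuous (@gauss_cdf R).
Proof. exact: (derivable_cvg_continuous is_derive_gauss_cdf). Qed.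

Lemma gauss_cdfE x : (gauss_cdf x)%:E = normal_prob 0 1 `]-oo, x].
Proof.
rewrite unlock /Rintegral fineK// -/(normal_prob 0 1 `]-oo, x]).
exact: fin_num_measure.
Qed.

Lemma gauss_cdf_ge0 x : 0 <= gauss_cdf x.
Proof. by rewrite -lee_fin gauss_cdfE. Qed.

Lemma gauss_cdf_le1 x : gauss_cdf x <= 1.
Proof. by rewrite -lee_fin gauss_cdfE probability_le1. Qed.

Lemma gauss_cdf_le x y : x <= y -> gauss_cdf x <= gauss_cdf y.
Proof.
move=> xy; rewrite -lee_fin !gauss_cdfE le_measure ?inE//.
by apply: subset_itvl; rewrite bnd_simp.
Qed.

(** The identity as a random variable under a normal law: normal laws live on
    [measurableTypeR R] and distributions on [R], whose measurable structures
    agree only extensionally. *)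
Definition normal_id : measurableTypeR R -> R := idfun.

HB.instance Definition _ :=
  @isMeasurableFun.Build _ _ (measurableTypeR R) R normal_id (@measurable_id _ _ setT).

Lemma cvg_normal_prob (m s : R) :
  fine (normal_prob m s `]-oo, x]) @[x --> +oo] --> (1 : R) /\
  fine (normal_prob m s `]-oo, x]) @[x --> -oo] --> (0 : R).
Proof.
split; first exact: (fine_cvg (cvg_cdfy1 (normal_id : {RV normal_prob m s >-> R}))).
exact: (fine_cvg (cvg_cdfNy0 (normal_id : {RV normal_prob m s >-> R}))).
Qed.

Lemma gauss_cdf_cvgy : gauss_cdf x @[x --> +oo] --> (1 : R).
Proof. rewrite unlock; exact: (cvg_normal_prob 0 1).1. Qed.

Lemma gauss_cdf_cvgNy : gauss_cdf x @[x --> -oo] --> (0 : R).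
Proof. rewrite unlock; exact: (cvg_normal_prob 0 1).2. Qed.

(** Both sides have the same derivative and the same limit at -oo; this avoids a
    change of variables in the integral. *)
Lemma normal_prob_gauss_cdf (s : R) x : 0 < s ->
  normal_prob 0 s `]-oo, x] = (gauss_cdf (x / s))%:E.
Proof.
move=> s0; pose F x := fine (normal_prob 0 s `]-oo, x]).
have sn0 : s != 0 by rewrite gt_eqF.
suff : F x = gauss_cdf (x / s).
  by move=> <-; rewrite /F fineK//; apply: fin_num_measure.
have dF y : is_derive y 1 F (normal_pdf 0 s y).
  have yu : y < y + 1 by rewrite ltrDl.
  have fi : lebesgue_measure.-integrable [set` Interval -oo%O (BRight (y + 1))]
      (EFin \o normal_pdf 0 s).
    by apply: (integrableS _ _ (subsetT _)) => //; exact: integrable_normal_pdf.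
  have [d1 d2] := continuous_FTC1 yu fi (ltNyr _) (@continuous_normal_pdf R 0 s sn0 y).
  by have := derivableP d1; rewrite -derive1E d2.
have dG y : is_derive y 1 (fun y => gauss_cdf (y / s)) (normal_pdf 0 s y).
  have H1 := is_deriveZ (s^-1) (is_derive_id y (1 : R)).
  have H2 := @is_derive1_comp _ gauss_cdf _ y _ _ (is_derive_gauss_cdf _) H1.
  apply: (is_derive_congr H2) => [z|]; first by rewrite /= /GRing.scale/= mulrC.
  rewrite /GRing.scale/= mulr1 !normal_pdfE ?oner_neq0// /normal_peak /normal_fun.
  rewrite mulrAC; congr (_ * expR _).
    rewrite expr1n mul1r -mulrnAr sqrtrM ?sqr_ge0// sqrtr_sqr gtr0_norm//.
    by rewrite invfM mulrC.
  by rewrite !subr0 expr1n /GRing.scale/=; field.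
have FG y : F y - gauss_cdf (y / s) = F 0 - gauss_cdf (0 / s).
  apply: (@is_derive_0_is_cst _ (fun y => F y - gauss_cdf (y / s))) => z.
  apply: (is_derive_congr (is_deriveB (dF z) (dG z))) => //.
  exact: subrr.
have lim0 : F y - gauss_cdf (y / s) @[y --> -oo] --> (0 : R).
  rewrite -[0]subr0; apply: cvgB; first exact: (cvg_normal_prob 0 s).2.
  apply: (@cvg_comp _ _ _ (fun y => y / s) gauss_cdf _ (-oo)); last exact: gauss_cdf_cvgNy.
  by apply: gt0_cvgMlNy; rewrite ?invr_gt0//; exact: cvg_id.
suff /eqP : F x - gauss_cdf (x / s) = 0 by rewrite subr_eq0 => /eqP.
have lim1 : F y - gauss_cdf (y / s) @[y --> -oo] --> F x - gauss_cdf (x / s).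
  rewrite (_ : (fun y => _) = cst (F x - gauss_cdf (x / s))); first exact: cvg_cst.
  by apply/funext => y; rewrite /= FG [RHS]FG.
exact: (cvg_unique _ lim1 lim0).
Qed.

(** The function [y |-> gauss_cdf y + gauss_cdf (- y)] is constant, with limit 1. *)
Lemma gauss_cdf0 : gauss_cdf (0 : R) = 2^-1.
Proof.
pose G y := gauss_cdf y + gauss_cdf (- y).
have GE y : G y = G 0.
  apply: (@is_derive_0_is_cst _ G) => z.
  have H1 := is_deriveN (is_derive_id z (1 : R)).
  have H2 := @is_derive1_comp _ gauss_cdf _ z _ _ (is_derive_gauss_cdf _) H1.
  have H3 := is_deriveD (is_derive_gauss_cdf z) H2.
  apply: (is_derive_congr H3) => //.
  by rewrite /= !normal_pdf01E fctE/= sqrrN mulrN1 subrr.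
have lim1 : G y @[y --> +oo] --> (1 : R).
  rewrite -[1]addr0; apply: cvgD; first exact: gauss_cdf_cvgy.
  apply: (@cvg_comp _ _ _ (fun y => - y) gauss_cdf _ (-oo)); last exact: gauss_cdf_cvgNy.
  by apply: (iffRL (cvgNrNy id)); exact: cvg_id.
have lim0 : G y @[y --> +oo] --> G 0.
  rewrite (_ : G = cst (G 0)); first exact: cvg_cst.
  by apply/funext => y; rewrite /= GE.
have : 1 = G 0 by exact: (cvg_unique _ lim1 lim0).
rewrite /G oppr0 => H.
by lra.
Qed.

(** Squaring [1 + u <= expR u] at [u = y ^+ 2 / 4] gives a bound by the inverse
    of a polynomial of degree 4, which dominates every polynomial factor met in
    the derivatives of [gauss_cdf] below. *)
Lemma normal_pdf_decay y : (1 + y ^+ 2 / 4) ^+ 2 * normal_pdf 0 1 y <= normal_peak 1.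
Proof.
rewrite normal_pdf01E mulrCA ler_piMr ?normal_peak_ge0//.
rewrite expRN -ler_pdivlMr ?invr_gt0 ?expR_gt0// invrK mul1r.
rewrite (_ : y ^+ 2 / 2 = y ^+ 2 / 4 + y ^+ 2 / 4); last by field.
rewrite expRD -expr2 lerXn2r ?nnegrE ?expR_ge0//.
  by rewrite addr_ge0// divr_ge0// sqr_ge0.
exact: expR_ge1Dx.
Qed.

Lemma normal_pdf_poly_bound (p : R -> R) c :
  (forall y, `|p y| <= c * (1 + y ^+ 2 / 4) ^+ 2) ->
  forall y, `|p y * normal_pdf 0 1 y| <= c * normal_peak 1.
Proof.
move=> bp y; rewrite normrM [X in _ * X]ger0_norm ?normal_pdf_ge0//.
have c0 : 0 <= c.
  have := le_trans (normr_ge0 _) (bp 0); rewrite expr0n/= mul0r addr0 expr1n.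
  by rewrite mulr1.
apply: (le_trans _ (ler_wpM2l c0 (normal_pdf_decay y))).
by rewrite mulrA ler_wpM2r ?normal_pdf_ge0.
Qed.

Lemma gauss_cdf_taylor : exists2 K : R, 0 <= K & forall x h,
  `|gauss_cdf (x + h) - gauss_cdf x - normal_pdf 0 1 x * h
    + 2^-1 * (x * normal_pdf 0 1 x) * h ^+ 2| <= K * `|h| ^+ 3.
Proof.
exists (4 * normal_peak 1) => [|x h]; first by rewrite mulr_ge0// normal_peak_ge0.
have d2 y : is_derive y 1 (fun y => - (y * normal_pdf 0 1 y))
    ((y ^+ 2 - 1) * normal_pdf 0 1 y).
  have H := is_deriveN (is_deriveM (is_derive_id y (1 : R)) (is_derive_normal_pdf y)).
  apply: (is_derive_congr H) => [z|]; first by rewrite /= fctE.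
  by rewrite /GRing.scale/=; ring.
have := @taylor3_bound gauss_cdf (normal_pdf 0 1) _ _ x h (4 * normal_peak 1)
  _ is_derive_gauss_cdf is_derive_normal_pdf d2.
rewrite mulrN mulNr opprK; apply; first by rewrite mulr_ge0// normal_peak_ge0.
apply: normal_pdf_poly_bound => y.
have y2 : 0 <= y ^+ 2 by exact: sqr_ge0.
by rewrite ler_norml; nra.
Qed.

(** The heat equation enters here: the time derivative of
    [gauss_cdf (y / sqrt t)] is half its second space derivative, which is the
    coefficient of [v] below.  The remainder is uniform in [y] because the second
    time derivative is a polynomial times the Gaussian density. *)
Lemma gauss_cdf_time_taylor (t0 : R) : 0 < t0 -> exists2 K : R, 0 <= K &
  forall y t v, t0 <= t -> 0 <= v ->
  `|gauss_cdf (y / Num.sqrt (t + v)) - gauss_cdf (y / Num.sqrt t)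
    + 2^-1 * (y / Num.sqrt t * normal_pdf 0 1 (y / Num.sqrt t)) / t * v|
  <= K * v ^+ 2.
Proof.
move=> t00; pose K : R := 4 * normal_peak 1 / t0 ^+ 2.
have K0 : 0 <= K by rewrite !mulr_ge0// ?normal_peak_ge0// invr_ge0 exprn_ge0// ltW.
exists K => // y t v t0t v0.
pose w t := y / Num.sqrt t.
pose q w : R := w * normal_pdf 0 1 w.
have dw (s : R) : 0 < s -> is_derive s 1 w (- (w s / (2 * s))).
  move=> s0; have sq0 : Num.sqrt s != 0 by rewrite gt_eqF// sqrtr_gt0.
  have H := is_deriveZ y (is_deriveV sq0 (is_derive1_sqrt s0)).
  apply: (is_derive_congr H) => [z|]; first by [].
  have su : 2 * s = 2 * Num.sqrt s ^+ 2 by rewrite sqr_sqrtr ?ltW.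
  by rewrite /w /GRing.scale/= su; field.
have d1 (s : R) : 0 < s -> is_derive s 1 (fun s => gauss_cdf (w s)) (- (2^-1 * q (w s) / s)).
  move=> s0.
  have H := @is_derive1_comp _ gauss_cdf w s _ _ (is_derive_gauss_cdf _) (dw _ s0).
  by apply: (is_derive_congr H) => //; rewrite /q; field; rewrite gt_eqF.
have d2 (s : R) : 0 < s -> is_derive s 1 (fun s => - (2^-1 * q (w s) / s))
    ((3 / 4 * w s - 4^-1 * w s ^+ 3) * normal_pdf 0 1 (w s) / s ^+ 2).
  move=> s0; have sn0 : s != 0 by rewrite gt_eqF.
  have dq (z : R) : is_derive z 1 q ((1 - z ^+ 2) * normal_pdf 0 1 z).
    have H := is_deriveM (is_derive_id z (1 : R)) (is_derive_normal_pdf z).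
    by apply: (is_derive_congr H) => //; rewrite /GRing.scale/=; ring.
  have dqw := @is_derive1_comp _ q w s _ _ (dq _) (dw _ s0).
  have H := is_deriveN (is_deriveM (is_deriveZ (2^-1 : R) dqw)
    (is_deriveV sn0 (is_derive_id s (1 : R)))).
  apply: (is_derive_congr H) => [z|]; first by rewrite /= !fctE.
  by rewrite /q /GRing.scale/= /GRing.scale/=; field.
pose f'' s := (3 / 4 * w s - 4^-1 * w s ^+ 3) * normal_pdf 0 1 (w s) / s ^+ 2.
have := @taylor2_bound (fun s => gauss_cdf (w s)) (fun s => - (2^-1 * q (w s) / s)) f'' t v K K0.
rewrite mulNr opprK [`|v|]ger0_norm//; apply.
have -> : Num.min t (t + v) = t by rewrite min_l ?lerDl.
have -> : Num.max t (t + v) = t + v by rewrite max_r ?lerDl.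
move=> z /andP[tz ztv].
have z0 : 0 < z by rewrite (lt_le_trans t00)// (le_trans t0t).
split; first exact: d1.
split; first exact: d2.
rewrite normrM /K [X in _ * X <= _]ger0_norm ?invr_ge0 ?exprn_ge0 ?(ltW z0)//.
rewrite ler_pM// ?invr_ge0 ?exprn_ge0 ?(ltW z0)//; last first.
  by rewrite lef_pV2 ?posrE ?exprn_gt0// lerXn2r ?nnegrE ?(ltW z0) ?(ltW t00)// (le_trans t0t).
apply: (@normal_pdf_poly_bound (fun w => 3 / 4 * w - 4^-1 * w ^+ 3)) => u.
have y2 : 0 <= u ^+ 2 by exact: sqr_ge0.
rewrite ler_norml; apply/andP; split; nra.
Qed.

(** One step of the Lindeberg replacement.  Displacing the space variable by [z]
    is expanded to third order, and increasing the time by [v] to second order;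
    the heat equation makes the second order term of the former match the first
    order term of the latter.  When [z] is an independent centred variable of
    variance [v], the two correction terms on the second and third lines have
    zero expectation. *)
Lemma heat_step (t0 : R) : 0 < t0 -> exists2 K : R, 0 <= K &
  forall y z t v, t0 <= t -> 0 <= v ->
  `|gauss_cdf ((y - z) / Num.sqrt t) - gauss_cdf (y / Num.sqrt (t + v))
    + normal_pdf 0 1 (y / Num.sqrt t) / Num.sqrt t * z
    + 2^-1 * (y / Num.sqrt t * normal_pdf 0 1 (y / Num.sqrt t)) / t * (z ^+ 2 - v)|
  <= K * (`|z| ^+ 3 + v ^+ 2).
Proof.
move=> t00; have [K1 K10 H1] := gauss_cdf_taylor.
have [K2 K20 H2] := gauss_cdf_time_taylor t00.
exists (K1 / Num.sqrt t0 ^+ 3 + K2) => [|y z t v t0t v0].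
  by rewrite addr_ge0// divr_ge0// exprn_ge0// sqrtr_ge0.
have t_gt0 : 0 < t by exact: lt_le_trans t0t.
have s0 : 0 < Num.sqrt t by rewrite sqrtr_gt0.
have {}H2 := H2 y t v t0t v0.
have {}H1 := H1 (y / Num.sqrt t) (- z / Num.sqrt t).
set a := y / Num.sqrt t in H1 H2 *.
rewrite (_ : (y - z) / Num.sqrt t = a + - z / Num.sqrt t); last by rewrite -mulrDl.
have z3 : `|- z / Num.sqrt t| ^+ 3 <= `|z| ^+ 3 / Num.sqrt t0 ^+ 3.
  rewrite normrM normrN exprMn ler_wpM2l ?exprn_ge0//.
  rewrite normfV [X in X^-1]gtr0_norm// -exprVn lerXn2r ?nnegrE ?invr_ge0 ?sqrtr_ge0//.
  by rewrite lef_pV2 ?posrE ?sqrtr_gt0// ler_wsqrtr.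
rewrite (_ : _ + _ = (gauss_cdf (a + - z / Num.sqrt t) - gauss_cdf a -
    normal_pdf 0 1 a * (- z / Num.sqrt t)
    + 2^-1 * (a * normal_pdf 0 1 a) * (- z / Num.sqrt t) ^+ 2)
  - (gauss_cdf (y / Num.sqrt (t + v)) - gauss_cdf a
    + 2^-1 * (a * normal_pdf 0 1 a) / t * v)); last first.
  have su : t = Num.sqrt t ^+ 2 by rewrite sqr_sqrtr ?ltW.
  by rewrite [in 2^-1 * _ / t]su; field; rewrite gt_eqF.
apply: (le_trans (ler_normB _ _)).
rewrite mulrDr; apply: lerD.
  apply: (le_trans H1); rewrite mulrDl mulrAC -mulrA.
  by rewrite -[leLHS]addr0 lerD ?ler_wpM2l// mulr_ge0 ?exprn_ge0.
by apply: (le_trans H2); rewrite mulrDl lerDr mulr_ge0 ?sqr_ge0// divr_ge0// exprn_ge0// sqrtr_ge0.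
Qed.

End gauss.

(** * Expectations of bounded random variables *)
Section bounded_expectation.
Context {R : realType} d (T : measurableType d) (P : probability T R).
Implicit Types f g : T -> R.

Definition bounded_rv f :=
  measurable_fun setT f /\ exists M : R, forall w, `|f w| <= M.

Lemma bounded_rv_integrable f : bounded_rv f -> P.-integrable setT (EFin \o f).
Proof.
move=> [mf [M fM]]; apply: measurable_bounded_integrable => //.
  by apply: (le_lt_trans (probability_le1 _ _)); rewrite ?ltry.
exists M; split; first exact: num_real.
by move=> x Mx w _; apply: (le_trans (fM w)); exact: ltW.
Qed.

Lemma bounded_rv_cst (c : R) : bounded_rv (cst c).
Proof. by split; [exact: measurable_cst|exists `|c|]. Qed.

Lemma bounded_rvD f g : bounded_rv f -> bounded_rv g ->
  bounded_rv (fun w => f w + g w).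
Proof.
move=> [mf [M fM]] [mg [N gN]]; split; first exact: measurable_funD.
by exists (M + N) => w; rewrite (le_trans (ler_normD _ _))// lerD.
Qed.

Lemma bounded_rvM f g : bounded_rv f -> bounded_rv g ->
  bounded_rv (fun w => f w * g w).
Proof.
move=> [mf [M fM]] [mg [N gN]]; split; first exact: measurable_funM.
by exists (M * N) => w; rewrite normrM ler_pM.
Qed.

Lemma bounded_rvZ (c : R) f : bounded_rv f -> bounded_rv (fun w => c * f w).
Proof. exact: (bounded_rvM (bounded_rv_cst c)). Qed.

Lemma bounded_rvB f g : bounded_rv f -> bounded_rv g ->
  bounded_rv (fun w => f w - g w).
Proof.
move=> bf bg; have := bounded_rvD bf (bounded_rvZ (-1) bg).
by under [X in bounded_rv X -> _]eq_fun do rewrite mulN1r.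
Qed.

Lemma bounded_rvX f n : bounded_rv f -> bounded_rv (fun w => f w ^+ n).
Proof.
move=> bf; elim: n => [|n IH]; first exact: (bounded_rv_cst 1).
by under eq_fun do rewrite exprS; exact: bounded_rvM.
Qed.

Lemma bounded_rv_norm f : bounded_rv f -> bounded_rv (fun w => `|f w|).
Proof.
move=> [mf [M fM]]; split; first exact: measurableT_comp.
by exists M => w; rewrite normr_id.
Qed.

Lemma bounded_rv_sum n (F : 'I_n -> T -> R) :
  (forall i, bounded_rv (F i)) -> bounded_rv (fun w => \sum_(i < n) F i w).
Proof.
elim: n F => [|n IH] F bF.
  by under eq_fun do rewrite big_ord0; exact: (bounded_rv_cst 0).
by under eq_fun do rewrite big_ord_recl; apply: bounded_rvD => //; exact: IH.
Qed.

Lemma expect_cst (c : R) : \int[P]_w c = c.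
Proof. by rewrite Rintegral_cst//= probability_setT mulr1. Qed.

Lemma expectD f g : bounded_rv f -> bounded_rv g ->
  \int[P]_w (f w + g w) = \int[P]_w f w + \int[P]_w g w.
Proof. by move=> /bounded_rv_integrable ? /bounded_rv_integrable ?; rewrite RintegralD. Qed.

Lemma expectB f g : bounded_rv f -> bounded_rv g ->
  \int[P]_w (f w - g w) = \int[P]_w f w - \int[P]_w g w.
Proof. by move=> /bounded_rv_integrable ? /bounded_rv_integrable ?; rewrite RintegralB. Qed.

Lemma expectZ (c : R) f : bounded_rv f ->
  \int[P]_w (c * f w) = c * \int[P]_w f w.
Proof. by move=> /bounded_rv_integrable ?; rewrite RintegralZl. Qed.

Lemma expect_le f g : bounded_rv f -> bounded_rv g -> (forall w, f w <= g w) ->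
  \int[P]_w f w <= \int[P]_w g w.
Proof. by move=> /bounded_rv_integrable ? /bounded_rv_integrable ? fg; exact: le_Rintegral. Qed.

Lemma expect_norm_le f : bounded_rv f ->
  `|\int[P]_w f w| <= \int[P]_w `|f w|.
Proof. by move=> /bounded_rv_integrable ?; exact: le_normr_Rintegral. Qed.

Lemma bounded_rv_indic (A : set T) : measurable A -> bounded_rv (\1_A : T -> R).
Proof.
move=> mA; split; first exact: measurable_indic.
by exists 1 => w; rewrite indicE; case: (_ \in _); rewrite ?normr1 ?normr0.
Qed.

Lemma expect_indic (A : set T) : measurable A -> \int[P]_w \1_A w = fine (P A).
Proof. by move=> mA; rewrite /Rintegral integral_indic// setIT. Qed.

End bounded_expectation.

(** * Independence *)
Section independence.
Context {R : realType} d (T : measurableType d) (P : probability T R).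

Lemma measurable_rect_unique (m1 m2 : {measure set (R * R) -> \bar R}) :
  (m1 setT < +oo)%E ->
  (forall A B : set R, measurable A -> measurable B -> m1 (A `*` B) = m2 (A `*` B)) ->
  forall D, measurable D -> m1 D = m2 D.
Proof.
move=> fin rect D mD.
pose C : set (set (R * R)) :=
  [set C | exists A, measurable A /\ exists B, measurable B /\ C = A `*` B].
apply: (measure_unique C (fun=> setT)) => //.
- rewrite measurable_prod_measurableType //; congr (<<s _ >>).
  rewrite predeqE; split => [[A mA [B mB <-]]|[A [mA [B [mB ->]]]]].
    by exists A; split => //; exists B.
  by exists A => //; exists B.
- move=> /= _ _ [X1 [mX1 [X2 [mX2 ->]]]] [Y1 [mY1 [Y2 [mY2 ->]]]].
  rewrite -setXI; exists (X1 `&` Y1); split; first exact: measurableI.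
  by exists (X2 `&` Y2); split => //; exact: measurableI.
- by move=> n; exists setT; split => //; exists setT; split; rewrite ?setXTT.
- by rewrite bigcup_const.
- by move=> A [A1 [mA1 [A2 [mA2 ->]]]]; exact: rect.
Qed.

Lemma measurable_preimage (f : T -> R) (A : set R) :
  measurable_fun setT f -> measurable A -> measurable (f @^-1` A).
Proof. by move=> mf mA; rewrite -[X in measurable X]setTI; exact: mf. Qed.

(** Independence of an event [E] from the pair [(S, Y)] need only be known on
    rectangles: both sides are finite measures of [D], and rectangles form a
    generating class stable under intersection. *)
Lemma indep_pair (S Y : T -> R) (E : set T) :
  measurable_fun setT S -> measurable_fun setT Y -> measurable E ->
  (forall A B : set R, measurable A -> measurable B ->
    P ((S @^-1` A `&` Y @^-1` B) `&` E) = (P (S @^-1` A `&` Y @^-1` B) * P E)%E) ->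
  forall D : set (R * R), measurable D ->
    P ((fun w => (S w, Y w)) @^-1` D `&` E)
    = (P ((fun w => (S w, Y w)) @^-1` D) * P E)%E.
Proof.
move=> mS mY mE rect D mD.
pose SY w := (S w, Y w).
have mSY : measurable_fun setT SY by exact: measurable_fun_pair.
have PE0 : 0 <= fine (P E) by rewrite fine_ge0.
pose m1 : {measure set (R * R) -> \bar R} :=
  measure_function_pushforward__canonical__measure_function_Measure (mrestr P mE) mSY.
pose m2 : {measure set (R * R) -> \bar R} := mscale (NngNum PE0)
  (measure_function_pushforward__canonical__measure_function_Measure P mSY).
have PEE : (fine (P E))%:E = P E by rewrite fineK// fin_num_measure.
have := @measurable_rect_unique m1 m2 _ _ D.
rewrite /m1 /m2 /= /mscale/= PEE /pushforward /mrestr/= muleC; apply => //.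
- by rewrite preimage_setT setTI (le_lt_trans (probability_le1 _ _))// ltry.
- by move=> A B mA mB; rewrite [RHS]muleC -rect.
Qed.

Definition indep2 (X Y : T -> R) := forall A B : set R,
  measurable A -> measurable B ->
  P (X @^-1` A `&` Y @^-1` B) = (P (X @^-1` A) * P (Y @^-1` B))%E.

(** Fubini, once the joint law of [(X, Y)] is identified with the product of the
    marginal laws. *)
Lemma indep2_expectM (X Y : T -> R) (phi psi : R -> R) :
  measurable_fun setT X -> measurable_fun setT Y -> indep2 X Y ->
  bounded_rv phi -> bounded_rv psi ->
  \int[P]_w (phi (X w) * psi (Y w)) = (\int[P]_w phi (X w)) * (\int[P]_w psi (Y w)).
Proof.
move=> mX mY iXY bphi bpsi.
pose X' : {RV P >-> R} := mfun_Sub (mem_set mX).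
pose Y' : {RV P >-> R} := mfun_Sub (mem_set mY).
have mXY : measurable_fun setT (fun w => (X w, Y w)) by exact: measurable_fun_pair.
pose XY' : {RV P >-> (R * R)%type} := mfun_Sub (mem_set mXY).
have bc (h : R -> R) (Z : T -> R) : measurable_fun setT Z -> bounded_rv h ->
    bounded_rv (fun w => h (Z w)).
  move=> mZ [mh [M hM]]; split; first exact: measurableT_comp.
  by exists M => w; exact: hM.
have eqE (h : R -> R) (Z : {RV P >-> R}) : bounded_rv h ->
    \int[P]_w h (Z w) = \int[distribution P Z]_y h y.
  move=> bh; rewrite /Rintegral [in RHS]integral_distribution//.
    by apply/measurable_EFinP; case: bh.
  exact: (bounded_rv_integrable _ (bc h Z _ bh)).
rewrite (eqE phi X')// (eqE psi Y')//.
pose g (z : R * R) := phi z.1 * psi z.2.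
have bg : bounded_rv g.
  case: bphi => mphi [M phiM]; case: bpsi => mpsi [N psiN]; split.
    by apply: measurable_funM; exact: measurableT_comp.
  by exists (M * N) => z; rewrite normrM ler_pM.
have prodE : forall D, measurable D ->
    distribution P XY' D = (distribution P X' \x distribution P Y')%E D.
  apply: measurable_rect_unique => [|A B mA mB].
    by rewrite /= /distribution /pushforward preimage_setT probability_setT ltry.
  by apply: etrans (esym (product_measure1E _ _ mA mB)); exact: iXY.
transitivity (\int[(distribution P X' \x distribution P Y')%E]_z g z).
  rewrite /Rintegral; congr fine.
  transitivity (\int[distribution P XY']_z (g z)%:E)%E; last first.
    by apply: eq_measure_integral => D mD _; exact: prodE.
  rewrite integral_distribution//.
    by apply/measurable_EFinP; case: bg.
  apply: bounded_rv_integrable; case: bg => mg [M gM]; split.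
    exact: measurableT_comp.
  by exists M => w; exact: gM.
rewrite /Rintegral -integral12_prod_meas1; last exact: bounded_rv_integrable.
rewrite -/(Rintegral (distribution P X') setT phi) -/(Rintegral (distribution P Y') setT psi).
transitivity (\int[distribution P X']_x (phi x * \int[distribution P Y']_y psi y)).
  rewrite /Rintegral; congr fine; apply: eq_integral => x _.
  rewrite -[in RHS](RintegralZl _ _ (bounded_rv_integrable _ bpsi))//.
  rewrite fineK//; apply: integrable_fin_num => //.
  exact: (bounded_rv_integrable _ (bounded_rvZ _ bpsi)).
by rewrite RintegralZr//; exact: bounded_rv_integrable.
Qed.

Section partial_sums.
Variables (n : nat) (Z : nat -> T -> R).
Hypothesis mZ : forall i, measurable_fun setT (Z i).
Hypothesis indepZ : forall A : nat -> set R, (forall i, measurable (A i)) ->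
  P (\bigcap_(i in `I_n) Z i @^-1` A i) = (\prod_(0 <= i < n) P (Z i @^-1` A i))%E.

Definition partial_sum k w : R := \sum_(0 <= i < k) Z i w.

(** Events on the coordinates not yet summed; independence of the partial sums
    is proved against all of them at once, which is what the induction needs. *)
Let tail k (A : nat -> set R) : set T :=
  \bigcap_(i in [set i | (k <= i < n)%N]) Z i @^-1` A i.

Let tailE k A : (forall i, measurable (A i)) ->
  P (tail k A) = (\prod_(k <= i < n) P (Z i @^-1` A i))%E.
Proof.
move=> mA; pose A' i := if (k <= i)%N then A i else setT.
have -> : tail k A = \bigcap_(i in `I_n) Z i @^-1` A' i.
  apply/seteqP; split => w /= Aw i /=.
    by move=> in_; rewrite /A'; case: ifPn => // ki; apply: Aw; rewrite /= ki.
  by move=> /andP[ki in_]; have := Aw i in_; rewrite /A' ki.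
rewrite indepZ => [|i]; last by rewrite /A'; case: ifPn.
have [kn|nk] := leqP k n.
  rewrite (big_cat_nat (leq0n k) kn)/= big1_seq ?mul1e.
    rewrite !big_nat; apply: eq_bigr => i /andP[ki _]; by rewrite /A' ki.
  move=> i /=; rewrite mem_index_iota => /andP[_ ik].
  by rewrite /A' leqNgt ik/= preimage_setT probability_setT.
rewrite [RHS]big_geq 1?ltnW// big1_seq// => i /=; rewrite mem_index_iota => /andP[_ ik].
by rewrite /A' leqNgt (ltn_trans ik nk)/= preimage_setT probability_setT.
Qed.

Let tail_split k A : (k < n)%N -> tail k A = Z k @^-1` A k `&` tail k.+1 A.
Proof.
move=> kn; apply/seteqP; split => w.
  move=> Aw; split; first by apply: Aw; rewrite /= leqnn.
  by move=> i /andP[ki in_]; apply: Aw; rewrite /= in_ (ltnW ki).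
move=> [Ak Aw] i /= /andP[]; rewrite leq_eqVlt => /predU1P[<-//|ki] in_.
by apply: Aw; rewrite /= ki.
Qed.

Let measurable_tail k A : (forall i, measurable (A i)) -> measurable (tail k A).
Proof.
by move=> mA; apply: bigcap_measurableType => // i _; exact: measurable_preimage.
Qed.

Lemma measurable_partial_sum k : measurable_fun setT (partial_sum k).
Proof. exact: measurable_sum. Qed.

(** By induction on [k]: [partial_sum k.+1] is a function of
    [(partial_sum k, Z k)], and for a rectangle the event on [Z k] can be
    absorbed into the tail event, where the induction hypothesis applies. *)
Let partial_sum_tail k : (k <= n)%N -> forall (B : set R) A, measurable B ->
  (forall i, measurable (A i)) ->
  P (partial_sum k @^-1` B `&` tail k A) = (P (partial_sum k @^-1` B) * P (tail k A))%E.
Proof.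
elim: k => [_|k IH kn] B A mB mA.
  have [B0|B0] := pselect (B 0).
    rewrite (_ : _ @^-1` B = setT) ?setTI ?probability_setT ?mul1e//.
    by apply/seteqP; split => // w _; rewrite /partial_sum /= big_geq.
  rewrite (_ : _ @^-1` B = set0) ?set0I ?measure0 ?mul0e//.
  by apply/seteqP; split => // w; rewrite /partial_sum /= big_geq.
have {}IH := IH (ltnW kn).
have -> : partial_sum k.+1 = fun w => partial_sum k w + Z k w.
  by apply/funext => w; rewrite /partial_sum big_nat_recr.
have mD : measurable ((fun z : R * R => z.1 + z.2) @^-1` B).
  rewrite -[X in measurable X]setTI.
  by apply: (measurable_funD measurable_fst measurable_snd).
have mt := measurable_tail k.+1 mA.
apply: (indep_pair (measurable_partial_sum k) (mZ k) mt _ mD) => B1 B2 mB1 mB2.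
pose A1 (A : nat -> set R) i := if i == k then B2 else A i.
have mA1 A0 : (forall i, measurable (A0 i)) -> forall i, measurable (A1 A0 i).
  by move=> mA0 i; rewrite /A1; case: ifPn.
have tA1 A0 : tail k (A1 A0) = Z k @^-1` B2 `&` tail k.+1 A0.
  rewrite tail_split//; congr (_ `&` _); first by rewrite /A1 eqxx.
  rewrite /tail; apply: eq_bigcapr => i /= /andP[ki _].
  by rewrite /A1 gtn_eqF.
have tT : tail k.+1 (fun=> setT) = setT.
  by apply/seteqP; split.
have PA1 A0 : (forall i, measurable (A0 i)) ->
    P (tail k (A1 A0)) = (P (Z k @^-1` B2) * P (tail k.+1 A0))%E.
  move=> mA0; rewrite !tailE//; last exact: mA1.
  rewrite big_ltn//; congr (_ * _)%E; first by rewrite /A1 eqxx.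
  rewrite !big_nat; apply: eq_bigr => i /andP[ki _].
  by rewrite /A1 gtn_eqF.
rewrite -setIA -tA1 IH//; last exact: mA1.
rewrite PA1// muleA; congr (_ * _)%E.
rewrite -[X in (_ `&` X)]setIT -tT -tA1 IH//; last exact: mA1.
by rewrite PA1// tT probability_setT mule1.
Qed.

Lemma indep2_partial_sum k : (k < n)%N -> indep2 (partial_sum k) (Z k).
Proof.
move=> kn A B mA mB; pose A1 i : set R := if i == k then B else setT.
have mA1 i : measurable (A1 i) by rewrite /A1; case: ifPn.
have <- : tail k A1 = Z k @^-1` B.
  rewrite tail_split// /A1 eqxx (_ : tail _ _ = setT) ?setIT//.
  by apply/seteqP; split => // w _ i /= /andP[ki _]; rewrite gtn_eqF.
by apply: partial_sum_tail => //; exact: ltnW.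
Qed.

End partial_sums.
End independence.

(** * The central limit theorem *)
Section clt.
Context {R : realType}.

(** The powers of [Y] are unbounded functions of its value; since [Y] itself is
    bounded, they can be replaced by powers of a clipped value. *)
Lemma indep2_expect_pow d (T : measurableType d) (P : probability T R)
    (X Y : T -> R) (phi : R -> R) n :
  measurable_fun setT X -> bounded_rv Y -> indep2 P X Y -> bounded_rv phi ->
  \int[P]_w (phi (X w) * Y w ^+ n) = (\int[P]_w phi (X w)) * (\int[P]_w Y w ^+ n).
Proof.
move=> mX [mY [M YM]] iXY bphi.
pose clip (y : R) : R := Num.max (- M) (Num.min y M).
have clipY w : clip (Y w) = Y w.
  by move: (YM w); rewrite ler_norml /clip => /andP[h1 h2]; rewrite min_l// max_r.
have bclip : bounded_rv (fun y => clip y ^+ n).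
  apply: bounded_rvX; split.
    by apply: measurable_maxr => //; exact: measurable_minr.
  exists `|M| => y; have := ler_norm M; have := ler_norm (- M); rewrite normrN.
  by rewrite ler_norml ge_max le_max le_min ge_min /clip => h1 h2; lra.
under eq_Rintegral do rewrite -clipY.
under [X in _ = _ * X]eq_Rintegral do rewrite -clipY.
exact: (indep2_expectM mX mY iXY bphi bclip).
Qed.

Lemma measurable_gauss_cdf : measurable_fun setT (@gauss_cdf R).
Proof. apply: continuous_measurable_fun; exact: continuous_gauss_cdf. Qed.

Lemma bounded_rv_gauss_cdf d (T : measurableType d) (X : T -> R) :
  measurable_fun setT X -> bounded_rv (fun w => gauss_cdf (X w)).
Proof.
move=> mX; split; first exact: (measurableT_comp measurable_gauss_cdf).
by exists 1 => w; rewrite ger0_norm ?gauss_cdf_ge0// gauss_cdf_le1.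
Qed.

Lemma bounded_rv_normal_pdf : bounded_rv (normal_pdf 0 1 : R -> R).
Proof.
split; first exact: measurable_normal_pdf.
exists (1 * normal_peak 1) => y; rewrite -[normal_pdf 0 1 y]mul1r.
apply: (@normal_pdf_poly_bound _ (fun=> 1)) => z.
by rewrite normr1 mul1r exprn_ege1// lerDl divr_ge0// sqr_ge0.
Qed.

Lemma bounded_rv_id_normal_pdf : bounded_rv (fun y : R => y * normal_pdf 0 1 y).
Proof.
split; first by apply: measurable_funM => //; exact: measurable_normal_pdf.
exists (4 * normal_peak 1) => y; apply: (@normal_pdf_poly_bound _ id) => z.
have z2 : 0 <= z ^+ 2 by exact: sqr_ge0.
by rewrite ler_norml; apply/andP; split; nra.
Qed.

Lemma bounded_rv_comp d (T : measurableType d) (h : R -> R) (X : T -> R) :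
  measurable_fun setT X -> bounded_rv h -> bounded_rv (fun w => h (X w)).
Proof.
move=> mX [mh [M hM]]; split; first exact: measurableT_comp.
by exists M => w; exact: hM.
Qed.

(** The summands are absorbed one at a time: passing from [k] to [k.+1] moves
    [Z k] into the space variable and removes its variance from the time [tau].
    By independence the correction terms of [heat_step] vanish in expectation,
    and the errors telescope. *)
Lemma lindeberg_gauss (t0 : R) : 0 < t0 -> exists2 K : R, 0 <= K &
  forall d (T : measurableType d) (P : probability T R) n (Z : nat -> T -> R),
  (forall i, bounded_rv (Z i)) ->
  (forall A : nat -> set R, (forall i, measurable (A i)) ->
    P (\bigcap_(i in `I_n) Z i @^-1` A i) = (\prod_(0 <= i < n) P (Z i @^-1` A i))%E) ->
  (forall i, \int[P]_w Z i w = 0) ->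
  let v i := \int[P]_w Z i w ^+ 2 in
  forall a, `|\int[P]_w gauss_cdf ((a - partial_sum Z n w) / Num.sqrt t0)
    - gauss_cdf (a / Num.sqrt (t0 + \sum_(0 <= i < n) v i))|
  <= K * \sum_(0 <= i < n) (\int[P]_w `|Z i w| ^+ 3 + v i ^+ 2).
Proof.
move=> t00; have [K K0 HK] := @heat_step R t0 t00; exists K => //.
move=> d T P n Z bZ indepZ EZ v a.
have mZ i : measurable_fun setT (Z i) by case: (bZ i).
have v0 i : 0 <= v i by apply: Rintegral_ge0 => w _; exact: sqr_ge0.
pose tau k := t0 + \sum_(k <= i < n) v i.
have tau_ge k : t0 <= tau k by rewrite lerDl sumr_ge0.
have tauS k : (k < n)%N -> tau k = tau k.+1 + v k.
  by move=> kn; rewrite /tau big_ltn// [v k + _]addrC addrA.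
have mS k := measurable_partial_sum mZ k.
suff main k : (k <= n)%N ->
    `|\int[P]_w gauss_cdf ((a - partial_sum Z k w) / Num.sqrt (tau k))
      - gauss_cdf (a / Num.sqrt (tau 0%N))|
    <= K * \sum_(0 <= i < k) (\int[P]_w `|Z i w| ^+ 3 + v i ^+ 2).
  have tn : tau n = t0 by rewrite /tau big_geq// addr0.
  have := main n (leqnn n); rewrite tn; exact.
elim: k => [_|k IH kn].
  rewrite big_geq// mulr0.
  under eq_Rintegral do rewrite /partial_sum big_geq// subr0.
  by rewrite expect_cst subrr normr0.
have {}IH := IH (ltnW kn).
rewrite big_nat_recr//= mulrDr.
set U := fun k w => gauss_cdf ((a - partial_sum Z k w) / Num.sqrt (tau k)).
rewrite -/(U k.+1) -/(U k) in IH *.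
have bU j : bounded_rv (U j).
  apply: bounded_rv_gauss_cdf; apply: measurable_funM => //.
  exact: measurable_funB.
(* the coefficients of Z k and of its centred square in the heat step *)
pose s := Num.sqrt (tau k.+1).
pose p (y : R) := normal_pdf 0 1 ((a - y) / s) / s.
pose q (y : R) := 2^-1 * ((a - y) / s * normal_pdf 0 1 ((a - y) / s)) / tau k.+1.
have mas : measurable_fun setT (fun y : R => (a - y) / s).
  by apply: measurable_funM => //; exact: measurable_funB.
have bp : bounded_rv p.
  have := bounded_rvZ s^-1 (bounded_rv_comp mas bounded_rv_normal_pdf).
  by rewrite /p; under eq_fun do rewrite mulrC.
have bq : bounded_rv q.
  have := bounded_rvZ (2^-1 / tau k.+1) (bounded_rv_comp mas bounded_rv_id_normal_pdf).
  by rewrite /q; under eq_fun do rewrite mulrAC.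
have bpS := bounded_rv_comp (mS k) bp.
have bqS := bounded_rv_comp (mS k) bq.
have bZ2 := bounded_rvX 2 (bZ k).
have ind := indep2_partial_sum mZ indepZ kn.
have EpZ : \int[P]_w (p (partial_sum Z k w) * Z k w) = 0.
  have := indep2_expect_pow 1 (mS k) (bZ k) ind bp.
  rewrite (_ : \int[P]_w Z k w ^+ 1 = 0) ?mulr0//.
  by rewrite -[RHS](EZ k).
have EqZ : \int[P]_w (q (partial_sum Z k w) * (Z k w ^+ 2 - v k)) = 0.
  under eq_Rintegral do rewrite mulrBr [_ * v k]mulrC.
  rewrite expectB ?expectZ//; [|exact: bounded_rvM|exact: bounded_rvZ].
  by rewrite (indep2_expect_pow 2 (mS k) (bZ k) ind bq) mulrC subrr.
have step : `|\int[P]_w U k.+1 w - \int[P]_w U k w|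
    <= K * (\int[P]_w `|Z k w| ^+ 3 + v k ^+ 2).
  have b1 := bounded_rvB (bU k.+1) (bU k).
  have b2 := bounded_rvM bpS (bZ k).
  have b3 := bounded_rvM bqS (bounded_rvB bZ2 (bounded_rv_cst T (v k))).
  have b4 := bounded_rvD (bounded_rvX 3 (bounded_rv_norm (bZ k))) (bounded_rv_cst T (v k ^+ 2)).
  have -> : \int[P]_w U k.+1 w - \int[P]_w U k w =
    \int[P]_w (U k.+1 w - U k w + p (partial_sum Z k w) * Z k w
      + q (partial_sum Z k w) * (Z k w ^+ 2 - v k)).
    rewrite expectD//; last exact: bounded_rvD.
    by rewrite expectD// EpZ EqZ !addr0 expectB.
  apply: (le_trans (expect_norm_le P (bounded_rvD (bounded_rvD b1 b2) b3))).
  have -> : K * (\int[P]_w `|Z k w| ^+ 3 + v k ^+ 2) =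
      \int[P]_w (K * (`|Z k w| ^+ 3 + v k ^+ 2)).
    rewrite expectZ// expectD ?expect_cst//.
      exact: bounded_rvX (bounded_rv_norm _).
    exact: (bounded_rv_cst T (v k ^+ 2)).
  apply: expect_le.
  - exact/bounded_rv_norm/(bounded_rvD (bounded_rvD b1 b2) b3).
  - exact: bounded_rvZ.
  move=> w; have := HK (a - partial_sum Z k w) (Z k w) (tau k.+1) (v k) (tau_ge _) (v0 _).
  rewrite -tauS// -[a - _ - _]addrA -opprD.
  rewrite (_ : partial_sum Z k w + Z k w = partial_sum Z k.+1 w); last first.
    by rewrite /partial_sum big_nat_recr.
  exact.
by rewrite (le_trans (ler_distD (\int[P]_w U k w) _ _))// addrC lerD.
Qed.

Lemma near_dist_le (I : Type) (F : set_system I) {FF : Filter F}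
  (f : I -> R) (l e : R) : f @ F --> l -> 0 < e -> \forall i \near F, `|l - f i| <= e.
Proof. by move=> fl; move/cvgrPdist_le : fl; apply. Qed.

Lemma cvg_gauss_cdf (I : Type) (F : set_system I) {FF : Filter F}
  (f : I -> R) (l : R) : f @ F --> l -> gauss_cdf (f i) @[i --> F] --> gauss_cdf l.
Proof. by apply: continuous_cvg; exact: continuous_gauss_cdf. Qed.

Lemma cvg_sqrt (I : Type) (F : set_system I) {FF : Filter F}
  (f : I -> R) (l : R) : f @ F --> l -> Num.sqrt (f i) @[i --> F] --> Num.sqrt l.
Proof. by apply: continuous_cvg; exact: sqrt_continuous. Qed.

(** For [V = 0] this is the distribution function of the point mass at 0, which
    lets degenerate and non-degenerate limits be treated together. *)
Definition normal_cdf (V x : R) : R :=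
  if V == 0 then (0 <= x)%R%:R else gauss_cdf (x / Num.sqrt V).

Lemma centered_normal_cdf (V x : R) : 0 <= V ->
  centered_normal V `]-oo, x] = (normal_cdf V x)%:E.
Proof.
move=> V0; rewrite /centered_normal /normal_cdf; have [_|Vn0] := eqVneq V 0.
  by rewrite diracE mem_setE in_itv.
by rewrite normal_prob_gauss_cdf// sqrtr_gt0 lt_def Vn0.
Qed.

Lemma inv_right0_cvgy : (x^-1 : R) @[x --> 0^'+] --> +oo.
Proof.
apply/(cvgrVy (f := id)); last exact: cvg_at_right_filter.
exact: nbhs_right_gt.
Qed.

Lemma smoothing_cvgy (x c : R) : 0 < x ->
  (x + c * e) / e ^+ 2 @[e --> 0^'+] --> +oo.
Proof.
move=> x0; apply/cvgryPge => A; near=> e.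
have e0 : 0 < e by near: e; exact: nbhs_right_gt.
have e1 : e <= 1 by near: e; exact: nbhs_right_le.
have ec : e <= x / (2 * (`|c| + 1)).
  by near: e; apply: nbhs_right_le; rewrite divr_gt0// mulr_gt0// ltr_wpDl.
have eA : e <= x / (2 * (`|A| + 1)).
  by near: e; apply: nbhs_right_le; rewrite divr_gt0// mulr_gt0// ltr_wpDl.
have xc : x / 2 <= x + c * e.
  suff : `|c * e| <= x / 2 by rewrite ler_norml => /andP[]; lra.
  rewrite normrM (gtr0_norm e0); apply: (@le_trans _ _ ((`|c| + 1) * (x / (2 * (`|c| + 1))))).
    by apply: ler_pM => //; rewrite ?lerDl ?(ltW e0).
  rewrite le_eqVlt; apply/orP; left; apply/eqP; field.
  by rewrite gt_eqF// ltr_wpDl.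
rewrite ler_pdivlMr ?exprn_gt0//; apply: le_trans xc.
apply: (@le_trans _ _ ((`|A| + 1) * e)).
  rewrite expr2 mulrA ler_wpM2r ?(ltW e0)//.
  rewrite (@le_trans _ _ (`|A| * e))// ?ler_wpM2r ?ler_norm ?(ltW e0)//.
  by rewrite (@le_trans _ _ (`|A| * 1)) ?ler_wpM2l// mulr1 lerDl.
apply: (@le_trans _ _ ((`|A| + 1) * (x / (2 * (`|A| + 1))))).
  by rewrite ler_wpM2l// addr_ge0.
rewrite le_eqVlt; apply/orP; left; apply/eqP; field.
by rewrite gt_eqF// ltr_wpDl.
Unshelve. all: by end_near. Qed.

(** Shifting by [e] and smoothing at time [e ^+ 4], that is at scale [e ^+ 2],
    recovers the distribution function as [e] tends to 0.  The scale is
    negligible against the shift, as the sandwich in the central limit theorem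
    requires; for [V = 0] the value at the jump [x = 0] must be excluded. *)
Lemma smoothing_cvg (V x c : R) : 0 <= V -> V != 0 \/ x != 0 ->
  gauss_cdf ((x + c * e) / Num.sqrt (e ^+ 4 + V)) @[e --> 0^'+] --> normal_cdf V x.
Proof.
move=> V0; rewrite /normal_cdf; have [->|Vn0 _] := eqVneq V 0.
  move=> -[//|x0].
  have E : \forall e \near (0:R)^'+, (x + c * e) / e ^+ 2 = (x + c * e) / Num.sqrt (e ^+ 4 + 0).
    near=> e; congr (_ / _); rewrite addr0 (exprM e 2 2) sqrtr_sqr ger0_norm//.
    exact: sqr_ge0.
  have [{}x0|{}x0|] := ltgtP 0 x; last by move=> x00; rewrite x00 eqxx in x0.
    apply: (@cvg_comp _ _ _ (fun e => (x + c * e) / Num.sqrt (e ^+ 4 + 0)) gauss_cdf _ (+oo)).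
      by apply: cvg_trans (smoothing_cvgy c x0); apply: near_eq_cvg.
    exact: gauss_cdf_cvgy.
  apply: (@cvg_comp _ _ _ (fun e => (x + c * e) / Num.sqrt (e ^+ 4 + 0)) gauss_cdf _ (-oo)).
    have : (- x + - c * e) / e ^+ 2 @[e --> 0^'+] --> +oo.
      by apply: smoothing_cvgy; rewrite oppr_gt0.
    move=> /cvgNrNy; apply: cvg_trans; apply: near_eq_cvg.
    near=> e; rewrite /= -(near E e)// fctE.
    by rewrite -mulNr opprD mulNr !opprK.
  exact: gauss_cdf_cvgNy.
have sV : Num.sqrt V != 0 by rewrite gt_eqF// sqrtr_gt0 lt_def Vn0.
apply: cvg_gauss_cdf.
apply: cvg_at_right_filter.
have -> : x / Num.sqrt V = (x + c * 0) / Num.sqrt (0 ^+ 4 + V).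
  by rewrite mulr0 addr0 expr0n/= add0r.
apply: cvgM.
  by apply: cvgD; [exact: cvg_cst|apply: cvgM; [exact: cvg_cst|exact: cvg_id]].
apply: cvgV; first by rewrite expr0n/= add0r.
apply: cvg_sqrt.
by apply: cvgD; [exact: exprn_continuous|exact: cvg_cst].
Unshelve. all: by end_near. Qed.

(** [gauss_cdf ((a - s) / sqrt t)] is a smoothed indicator of [s <= a] whose
    expectation converges by [lindeberg_gauss].  Taking [a = x + e] and
    [a = x - e] with [t = e ^+ 4] bounds the probability of [S <= x] from above
    and below, up to the Gaussian tail beyond [1 / e]. *)
Theorem lyapunov_clt (d : nat -> measure_display)
    (T : forall k, measurableType (d k)) (P : forall k, probability (T k) R)
    (n : nat -> nat) (Z : forall k, nat -> T k -> R) (V x : R) :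
  (forall k i, bounded_rv (Z k i)) ->
  (forall k (A : nat -> set R), (forall i, measurable (A i)) ->
    P k (\bigcap_(i in `I_(n k)) Z k i @^-1` A i)
    = (\prod_(0 <= i < n k) P k (Z k i @^-1` A i))%E) ->
  (forall k i, \int[P k]_w Z k i w = 0) ->
  let v k i := \int[P k]_w Z k i w ^+ 2 in
  \sum_(0 <= i < n k) v k i @[k --> \oo] --> V ->
  \sum_(0 <= i < n k) (\int[P k]_w `|Z k i w| ^+ 3 + v k i ^+ 2) @[k --> \oo] --> (0 : R) ->
  V != 0 \/ x != 0 ->
  fine (P k [set w | partial_sum (Z k) (n k) w <= x]) @[k --> \oo] --> normal_cdf V x.
Proof.
move=> bZ indepZ EZ v cV c0 Vx.
have v0 k i : 0 <= v k i by apply: Rintegral_ge0 => w _; exact: sqr_ge0.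
have V0 : 0 <= V.
  by apply: (cvgr_to_ge cV); near=> k; rewrite sumr_ge0.
pose S k := partial_sum (Z k) (n k).
have mS k : measurable_fun setT (S k).
  by apply: measurable_partial_sum => i; case: (bZ k i).
have smooth (t0 a : R) : 0 < t0 -> \int[P k]_w gauss_cdf ((a - S k w) / Num.sqrt t0) @[k --> \oo]
    --> gauss_cdf (a / Num.sqrt (t0 + V)).
  move=> t00; have [K K0 HK] := lindeberg_gauss t00.
  have lim1 : gauss_cdf (a / Num.sqrt (t0 + \sum_(0 <= i < n k) v k i)) @[k --> \oo]
     --> gauss_cdf (a / Num.sqrt (t0 + V)).
    apply: cvg_gauss_cdf.
    apply: cvgM; first exact: cvg_cst.
    apply: cvgV; first by rewrite gt_eqF// sqrtr_gt0 ltr_pwDl.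
    apply: cvg_sqrt.
    by apply: cvgD => //; exact: cvg_cst.
  have lim2 : \int[P k]_w gauss_cdf ((a - S k w) / Num.sqrt t0) -
      gauss_cdf (a / Num.sqrt (t0 + \sum_(0 <= i < n k) v k i)) @[k --> \oo] --> (0 : R).
    have cK : K * \sum_(0 <= i < n k) (\int[P k]_w `|Z k i w| ^+ 3 + v k i ^+ 2)
        @[k --> \oo] --> (0 : R).
      by rewrite -[X in _ --> X](mulr0 K); apply: cvgM => //; exact: cvg_cst.
    apply/cvgr0Pnorm_le => e e0; near=> k.
    apply: (le_trans (HK _ _ (P k) _ _ (bZ k) (indepZ k) (EZ k) a)).
    apply: (le_trans (ler_norm _)).
    by near: k; move/cvgr0Pnorm_le : cK; apply.
  pose A k := \int[P k]_w gauss_cdf ((a - S k w) / Num.sqrt t0).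
  pose B k := gauss_cdf (a / Num.sqrt (t0 + \sum_(0 <= i < n k) v k i)).
  rewrite -/A (_ : A = fun k => (A k - B k) + B k).
    by rewrite -[X in _ --> X]add0r; exact: cvgD.
  by apply/funext => k; rewrite subrK.
have mset k : measurable [set w | S k w <= x].
  rewrite (_ : [set _ | _] = S k @^-1` `]-oo, x]); first exact: measurable_preimage.
  by apply/seteqP; split => w /=; rewrite in_itv.
pose F k := fine (P k [set w | S k w <= x]).
have FE k : F k = \int[P k]_w \1_[set w | S k w <= x] w by rewrite expect_indic.
pose G k (e c : R) := \int[P k]_w gauss_cdf ((x + c * e - S k w) / Num.sqrt (e ^+ 4)).
have sq4 (e : R) : 0 < e -> Num.sqrt (e ^+ 4) = e ^+ 2.
  by move=> e0; rewrite (exprM e 2 2) sqrtr_sqr ger0_norm// sqr_ge0.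
have bG k e c : bounded_rv (fun w => gauss_cdf ((x + c * e - S k w) / Num.sqrt (e ^+ 4))).
  apply: bounded_rv_gauss_cdf; apply: measurable_funM => //.
  exact: measurable_funB.
have upper k e : 0 < e -> F k <= G k e 1 + (1 - gauss_cdf e^-1).
  move=> e0; rewrite FE -[X in _ + X](expect_cst (P k)) -expectD//; last first.
    exact: (bounded_rv_cst _ (1 - gauss_cdf e^-1)).
  apply: expect_le => [||w].
  - exact: bounded_rv_indic.
  - by apply: bounded_rvD => //; exact: (bounded_rv_cst _ (1 - gauss_cdf e^-1)).
  rewrite indicE; have [|_] := boolP (w \in _); last first => /=.
    by rewrite addr_ge0 ?gauss_cdf_ge0// subr_ge0 gauss_cdf_le1.
  rewrite inE/= => Sx; rewrite addrCA lerDl subr_ge0 gauss_cdf_le// sq4//.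
  rewrite ler_pdivlMr ?exprn_gt0// expr2 mulKf ?gt_eqF//; lra.
have lower k e : 0 < e -> G k e (-1) - gauss_cdf (- e^-1) <= F k.
  move=> e0; rewrite FE -[X in _ - X](expect_cst (P k)) -expectB//; last first.
    exact: (bounded_rv_cst _ (gauss_cdf (- e^-1))).
  apply: expect_le => [||w].
  - by apply: bounded_rvB => //; exact: (bounded_rv_cst _ (gauss_cdf (- e^-1))).
  - exact: bounded_rv_indic.
  rewrite indicE; have [_|] := boolP (w \in _) => /=.
    by rewrite lerBlDr (le_trans (gauss_cdf_le1 _))// lerDl gauss_cdf_ge0.
  rewrite notin_setE/= => /negP; rewrite -ltNge => Sx.
  rewrite subr_le0 gauss_cdf_le// sq4//.
  rewrite ler_pdivrMr ?exprn_gt0//.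
  by rewrite (_ : - e^-1 * e ^+ 2 = - e); [lra|field; rewrite gt_eqF].
apply/cvgrPdist_le => e e0.
have e40 : 0 < e / 4 by rewrite divr_gt0.
have [h h0 [H1 H2 H3 H4]] : exists2 h : R, 0 < h & [/\
    `|normal_cdf V x - gauss_cdf ((x + 1 * h) / Num.sqrt (h ^+ 4 + V))| <= e / 4,
    `|normal_cdf V x - gauss_cdf ((x + -1 * h) / Num.sqrt (h ^+ 4 + V))| <= e / 4,
    `|1 - gauss_cdf h^-1| <= e / 4 & `|0 - gauss_cdf (- h^-1)| <= e / 4].
  have C1 := near_dist_le (smoothing_cvg 1 V0 Vx) e40.
  have C2 := near_dist_le (smoothing_cvg (-1) V0 Vx) e40.
  have C3 := near_dist_le (cvg_comp _ _ inv_right0_cvgy (@gauss_cdf_cvgy R)) e40.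
  have C4' : (- x^-1 : R) @[x --> 0^'+] --> -oo.
    by apply: (iffRL (cvgNrNy (fun x : R => x^-1))); exact: inv_right0_cvgy.
  have C4 := near_dist_le (cvg_comp _ _ C4' (@gauss_cdf_cvgNy R)) e40.
  near (0 : R)^'+ => h; exists h; first by near: h; exact: nbhs_right_gt.
  by split; near: h; [exact: C1|exact: C2|exact: C3|exact: C4].
have h40 : 0 < h ^+ 4 by rewrite exprn_gt0.
have N c : \forall k \near \oo,
    `|gauss_cdf ((x + c * h) / Num.sqrt (h ^+ 4 + V)) - G k h c| <= e / 4.
  exact: (near_dist_le (smooth (h ^+ 4) (x + c * h) h40) e40).
apply: filterS2 (N 1) (N (-1)) => k B1 B2.
have := upper k h h0; have := lower k h h0; rewrite -/(F k).
move: H1 H2 H3 H4 B1 B2; rewrite !ler_norml; lra.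
Unshelve. all: by end_near. Qed.

End clt.

(** * Sample medians *)
Section median_theory.
Context {R : realType}.
Implicit Types (s t : seq R) (x y : R).

Lemma le_nth_sort_map (I : eqType) (l : seq I) (f g : I -> R) k :
  (forall i, i \in l -> f i <= g i) ->
  (sort <=%R [seq f i | i <- l])`_k <= (sort <=%R [seq g i | i <- l])`_k.
Proof.
move=> fg; have [kl|lk] := ltnP k (size l); last first.
  by rewrite !nth_default ?size_sort ?size_map.
rewrite le_nth_sort ?size_map//.
have : (sort <=%R [seq g i | i <- l])`_k <= (sort <=%R [seq g i | i <- l])`_k by [].
rewrite {1}le_nth_sort ?size_map// => /leq_trans; apply.
move: ((sort _ _)`_k) => y; rewrite !count_map.
elim: l fg {kl} => //= i l IH fg; apply: leq_add.
  case: (boolP (g i <= y)) => // giy.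
  by rewrite (le_trans _ giy)// fg// mem_head.
by apply: IH => j jl; rewrite fg// inE jl orbT.
Qed.

Lemma le_median_map (I : eqType) (l : seq I) (f g : I -> R) :
  (forall i, i \in l -> f i <= g i) ->
  median [seq f i | i <- l] <= median [seq g i | i <- l].
Proof.
move=> fg; rewrite /median !size_map; case: ifPn => _.
  exact: le_nth_sort_map.
by rewrite ler_pM2r// lerD//; exact: le_nth_sort_map.
Qed.

Lemma nth_sort_affine (a c : R) s k : 0 < a -> (k < size s)%N ->
  (sort <=%R [seq a * (y - c) | y <- s])`_k = a * ((sort <=%R s)`_k - c).
Proof.
move=> a0 ks; rewrite sort_map (nth_map 0) ?size_sort//.
suff -> : relpre (fun y => a * (y - c)) <=%R = <=%R :> rel R by [].
by apply/funext => x; apply/funext => y /=; rewrite ler_pM2l// lerD2r.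
Qed.

Lemma median_affine (a c : R) s : 0 < a -> (0 < size s)%N ->
  median [seq a * (y - c) | y <- s] = a * (median s - c).
Proof.
move=> a0 s0; rewrite /median size_map.
have h1 : ((size s)./2 < size s)%N by rewrite ltn_half_double -addnn -{1}[size s]addn0 ltn_add2l.
have h2 : ((size s)./2.-1 < size s)%N by rewrite (leq_ltn_trans (leq_pred _)).
case: ifPn => _; first by rewrite nth_sort_affine.
by rewrite !nth_sort_affine//; field.
Qed.

(** With [count_median_le], compares the median with a level through the number
    of entries below that level.  The two conditions differ only when exactly
    half of the entries lie below it, where the average of the two middle
    entries decides. *)
Lemma median_le_count s y : (size s < 2 * count (fun z => (z <= y)%R) s)%N ->
  median s <= y.
Proof.
set c := count _ _ => sc.
have c_gt : ((size s)./2 < c)%N by rewrite ltn_half_double -mul2n.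
have cs : (c <= size s)%N by exact: count_size.
have h1 : (sort <=%R s)`_((size s)./2) <= y.
  by rewrite le_nth_sort// (leq_trans c_gt).
have h2 : (sort <=%R s)`_((size s)./2.-1) <= y.
  by rewrite le_nth_sort// ?(leq_ltn_trans (leq_pred _))// (leq_trans c_gt).
by rewrite /median; case: ifPn => // _; lra.
Qed.

Lemma count_median_le s y : (0 < size s)%N -> median s <= y ->
  (size s <= 2 * count (fun z => (z <= y)%R) s)%N.
Proof.
move=> s0; rewrite /median; set c := count _ _; case: ifPn => [os|es].
  rewrite le_nth_sort; last first.
    by rewrite ltn_half_double -addnn -{1}[size s]addn0 ltn_add2l.
  rewrite -/c => h; rewrite -[X in (X <= _)%N]odd_double_half os mul2n add1n.
  by rewrite ltn_double.
set k := (size s)./2.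
have sk : size s = k.*2 by rewrite -[LHS]odd_double_half (negbTE es).
have k0 : (0 < k)%N by move: s0; rewrite sk double_gt0.
have ks : (k < size s)%N by rewrite sk -addnn -{1}[k]addn0 ltn_add2l.
have mono : (sort <=%R s)`_k.-1 <= (sort <=%R s)`_k.
  rewrite le_nth_sort ?(leq_ltn_trans (leq_pred _))//.
  have : (sort <=%R s)`_k <= (sort <=%R s)`_k by [].
  by rewrite {1}le_nth_sort//; apply: leq_ltn_trans; exact: leq_pred.
move=> h; have : (sort <=%R s)`_k.-1 <= y by lra.
have k1s : (k.-1 < size s)%N by exact: leq_ltn_trans (leq_pred _) ks.
rewrite le_nth_sort// -/c => kc.
by rewrite sk mul2n leq_double -(prednK k0).
Qed.

End median_theory.

(** * Convergence of medians for a fixed number of copies *)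
Section median_cvg.
Context {R : realType}.

(** The offset by half a step keeps 0 off the grid: the distribution functions
    of the individual copies are known to converge only away from 0, where the
    limit law may have an atom. *)
Definition grid (n : nat) (dl : R) (i : nat) : R := (i%:R - n%:R - 2^-1) * dl.

Lemma grid_neq0 n dl i : dl != 0 -> grid n dl i != 0.
Proof.
move=> dl0; rewrite mulf_neq0//; apply/eqP => h.
have /eqP : (i.*2)%:R = (n.*2).+1%:R :> R by rewrite -natr1 -!mul2n !natrM; lra.
by rewrite eqr_nat => /eqP/(congr1 odd); rewrite /= !odd_double.
Qed.

Lemma gridS n dl i : grid n dl i.+1 = grid n dl i + dl.
Proof. by rewrite /grid -natr1; ring. Qed.

Lemma grid_cover n dl k y : grid n dl 0 < y -> y <= grid n dl k ->
  exists i : 'I_k, grid n dl i < y <= grid n dl i.+1.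
Proof.
move=> y0; elim: k => [|k IH] yk; first by move: (lt_le_trans y0 yk); rewrite ltxx.
have [yk'|ky] := leP y (grid n dl k).
  have [i iy] := IH yk'; exists (widen_ord (leqnSn k) i); exact: iy.
by exists ord_max; rewrite ky yk.
Qed.

Lemma expect_sum d (T : measurableType d) (P : probability T R) (I : Type)
    (l : seq I) (p : pred I) (f : I -> T -> R) :
  (forall i, bounded_rv (f i)) ->
  bounded_rv (fun w => \sum_(i <- l | p i) f i w) /\
  \int[P]_w (\sum_(i <- l | p i) f i w) = \sum_(i <- l | p i) \int[P]_w f i w.
Proof.
move=> bf; elim: l => [|i l [b1 e1]].
  split; first by under eq_fun do rewrite big_nil; exact: (bounded_rv_cst _ 0).
  by under eq_Rintegral do rewrite big_nil; rewrite expect_cst big_nil.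
have [pi|npi] := boolP (p i); last first.
  split; first by under eq_fun do rewrite big_cons (negbTE npi).
  by under eq_Rintegral do rewrite big_cons (negbTE npi); rewrite big_cons (negbTE npi).
split; first by under eq_fun do rewrite big_cons pi; exact: bounded_rvD.
by under eq_Rintegral do rewrite big_cons pi; rewrite expectD// e1 big_cons pi.
Qed.

Lemma fine_cdf_itv d (T : measurableType d) (P : probability T R)
    (X : {RV P >-> R}) (a b : R) : a <= b ->
  fine (P (X @^-1` `]a, b])) = fine (cdf X b) - fine (cdf X a).
Proof.
move=> ab; rewrite -fineB ?fin_num_measure//; congr fine.
rewrite /cdf -[RHS]/(P (X @^-1` `]-oo, b]) - P (X @^-1` `]-oo, a]))%E.
have ma (c : R) : measurable (X @^-1` `]-oo, c]) by exact: measurable_funPTI.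
rewrite (_ : X @^-1` `]a, b] = X @^-1` `]-oo, b] `\` X @^-1` `]-oo, a]); last first.
  apply/seteqP; split => w /=; rewrite !in_itv/=.
    by move=> /andP[aX ->]; split => //; apply/negP; rewrite -ltNge.
  by move=> [-> /negP]; rewrite -ltNge => ->.
rewrite measureD//; last by rewrite (le_lt_trans (probability_le1 _ _))// ltry.
congr (_ - P _)%E; apply/seteqP; split => w /=; rewrite !in_itv/=; first by case.
by move=> Xa; split => //; exact: le_trans ab.
Qed.

Section boxes.
Context (r K : nat) (g : nat -> R).
Hypothesis g_nd : forall i, g i <= g i.+1.

(** By independence, the probability that each [X j] falls in its chosen cell
    [c j]; as a polynomial in values of the distribution functions it passes to
    the limit. *)
Definition box_weight (F : 'I_r -> R -> R) (c : {ffun 'I_r -> 'I_K}) : R :=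
  \prod_(j < r) (F j (g (c j).+1) - F j (g (c j))).

Definition box_sum (F : 'I_r -> R -> R) (x : R) : R :=
  \sum_(c : {ffun 'I_r -> 'I_K} | median [seq g (c j) | j <- enum 'I_r] <= x)
    box_weight F c.

Context d (T : measurableType d) (P : probability T R) (X : 'I_r -> {RV P >-> R}).
Hypothesis indepX : mutually_independent P X.

Let F j y := fine (cdf (X j) y).

Let box (c : {ffun 'I_r -> 'I_K}) : set T :=
  \bigcap_(j in [set` [set: 'I_r]%SET]) X j @^-1` `]g (c j), g (c j).+1].

Let boxP c w : box c w <-> forall j, g (c j) < X j w <= g (c j).+1.
Proof.
split; first by move=> bw j; have := bw j; rewrite /= finset.in_setT in_itv; apply.
by move=> bw j _; rewrite /= in_itv/=; exact: bw.
Qed.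

Let measurable_box c : measurable (box c).
Proof.
by apply: fin_bigcap_measurable => // j _; exact: measurable_funPTI.
Qed.

Let prob_box c : \int[P]_w \1_(box c) w = box_weight F c.
Proof.
rewrite expect_indic//.
have -> : P (box c) = (\prod_(j in [set: 'I_r]%SET) P (X j @^-1` `]g (c j), g (c j).+1]))%E.
  exact: (indepX [set: 'I_r]%SET (A := fun j => `]g (c j), g (c j).+1]%classic)).
rewrite (eq_bigr (fun j => (F j (g (c j).+1) - F j (g (c j)))%:E)) => [|j _]; last first.
  by rewrite -fine_cdf_itv// fineK// fin_num_measure//; exact: measurable_funPTI.
rewrite (eq_bigl predT) => [|j]; last by rewrite finset.in_setT.
by rewrite -[RHS]/(fine (box_weight F c)%:E) /box_weight; congr fine;
  elim/big_rec2 : _ => // j y1 y2 _ ->.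
Qed.

Let g_le i j : (i <= j)%N -> g i <= g j.
Proof. by move=> ij; apply: (homo_leq (@lexx _ R) (@le_trans _ R)). Qed.

Let measurable_median (x : R) : measurable [set w | median_rv X w <= x].
Proof.
rewrite (_ : [set _ | _] = median_rv X @^-1` `]-oo, x]); first exact: measurable_funPTI.
by apply/seteqP; split => w /=; rewrite in_itv.
Qed.

(** Outside the boxes some [X j] leaves the range of the grid.  Inside a box the
    median of the left endpoints is at most the median of the sample, so
    [median <= x] only meets boxes that are counted. *)
Lemma box_upper (x : R) :
  (forall y, g 0 < y <= g K -> exists i : 'I_K, g i < y <= g i.+1) ->
  fine (P [set w | median_rv X w <= x])
  <= box_sum F x + \sum_(j < r) (1 - (F j (g K) - F j (g 0))).
Proof.
move=> cover.
pose out j : set T := X j @^-1` (~` `]g 0, g K]).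
have mout j : measurable (out j) by apply: measurable_funPTI; exact: measurableC.
have [b1 e1] := @expect_sum _ _ P _ (index_enum {ffun 'I_r -> 'I_K})
  (fun c => median [seq g (c j) | j <- enum 'I_r] <= x) (fun c => \1_(box c))
  (fun c => bounded_rv_indic (measurable_box c)).
have [b2 e2] := @expect_sum _ _ P _ (index_enum 'I_r) predT (fun j => \1_(out j))
  (fun j => bounded_rv_indic (mout j)).
rewrite -expect_indic// /box_sum.
under eq_bigr do rewrite -prob_box.
rewrite -e1.
have -> : \sum_(j < r) (1 - (F j (g K) - F j (g 0))) = \sum_(j < r) \int[P]_w \1_(out j) w.
  apply: eq_bigr => j _; rewrite expect_indic// -fine_cdf_itv ?g_le//.
  have mi : measurable (X j @^-1` `]g 0, g K]) by exact: measurable_funPTI.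
  by rewrite /out preimage_setC probability_setC// fineB ?fin_num_measure.
rewrite -e2 -expectD//; apply: expect_le; [exact: bounded_rv_indic|exact: bounded_rvD|].
move=> w.
have s1 : 0 <= \sum_(c : {ffun 'I_r -> 'I_K} | median [seq g (c j) | j <- enum 'I_r] <= x) \1_(box c) w :> R.
  by apply: sumr_ge0 => c _; rewrite indicE.
have s2 : 0 <= \sum_(j < r) \1_(out j) w :> R by apply: sumr_ge0 => j _; rewrite indicE.
rewrite [X in X <= _]indicE; have [|_] := boolP (w \in _); last by rewrite addr_ge0.
rewrite inE/= => mx.
have [/existsP[j jout]|] := boolP [exists j, ~~ (g 0 < X j w <= g K)].
  rewrite (bigD1 j)//= [\1_(out j) w]indicE mem_set/=.
    by rewrite addrCA lerDl addr_ge0//; apply: sumr_ge0 => i _; rewrite indicE.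
  by rewrite /out /preimage /setC /mkset /= in_itv/=; exact/negP.
rewrite negb_exists => /forallP inall.
have /choice[c0 cP] : forall j, exists i : 'I_K, g i < X j w <= g i.+1.
  by move=> j; apply: cover; have := inall j; rewrite negbK.
pose c : {ffun 'I_r -> 'I_K} := finfun c0.
have cw : box c w by apply/boxP => j; rewrite ffunE.
have cx : median [seq g (c j) | j <- enum 'I_r] <= x.
  apply: le_trans mx; apply: le_median_map => j _; rewrite ffunE.
  by have /andP[/ltW] := cP j.
rewrite (bigD1 c)//= [\1_(box c) w]indicE mem_set//=.
by rewrite -!addrA lerDl addr_ge0//; apply: sumr_ge0 => i _; rewrite indicE.
Qed.

(** The boxes are disjoint, and on each of them the sample median exceeds the
    median of the left endpoints by at most the mesh [dl]. *)
Lemma box_lower (dl x : R) : (0 < r)%N -> (forall i, g i.+1 = g i + dl) ->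
  box_sum F (x - dl) <= fine (P [set w | median_rv X w <= x]).
Proof.
move=> r0 gS.
have [b1 e1] := @expect_sum _ _ P _ (index_enum {ffun 'I_r -> 'I_K})
  (fun c => median [seq g (c j) | j <- enum 'I_r] <= x - dl) (fun c => \1_(box c))
  (fun c => bounded_rv_indic (measurable_box c)).
rewrite -expect_indic// /box_sum.
under eq_bigr do rewrite -prob_box.
rewrite -e1; apply: expect_le => //; first exact: bounded_rv_indic.
move=> w; have [/existsP[c /asboolP cw]|] := boolP [exists c, `[< box c w >]]; last first.
  rewrite negb_exists => /forallP nb; rewrite big1 => [|c _]; first by rewrite indicE.
  by rewrite indicE memNset// => /asboolP; apply/negP/nb.
have other c' : c' != c -> \1_(box c') w = 0 :> R.
  move=> c'c; rewrite indicE memNset// => c'w; case/eqP : c'c.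
  apply/ffunP => j; apply/val_inj => /=.
  move/boxP : cw => /(_ j) /andP[a1 a2]; move/boxP : c'w => /(_ j) /andP[a3 a4].
  apply/eqP; rewrite eqn_leq; apply/andP; split; rewrite leqNgt; apply/negP => /g_le h.
    by have := lt_le_trans a3 (le_trans a2 h); rewrite ltxx.
  by have := lt_le_trans a1 (le_trans a4 h); rewrite ltxx.
have [mc|mc] := leP (median [seq g (c j) | j <- enum 'I_r]) (x - dl); last first.
  rewrite big1 => [|c' mc']; first by rewrite indicE.
  by apply: other; apply: contraTneq mc' => ->; rewrite -ltNge.
rewrite (bigD1 c)//= big1 ?addr0 => [|c' /andP[_]]; last exact: other.
rewrite !indicE mem_set// mem_set//=.
rewrite -lerBDr in mc; apply: le_trans mc.
have -> : median [seq g (c j) | j <- enum 'I_r] - - dl =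
    median [seq 1 * (y - - dl) | y <- [seq g (c j) | j <- enum 'I_r]].
  have sz : (0 < size [seq g (c j) | j <- enum 'I_r])%N by rewrite size_map size_enum_ord.
  by rewrite (median_affine _ ltr01 sz) mul1r.
rewrite -map_comp.
apply: le_median_map => j _ /=; rewrite mul1r opprK -gS.
by move/boxP : cw => /(_ j) /andP[].
Qed.

End boxes.

End median_cvg.

Section median_limit.
Context {R : realType}.

Lemma cvg_sumr (J I : Type) (F : set_system J) {FF : Filter F} (l : seq I)
    (p : pred I) (f : I -> J -> R) (f0 : I -> R) :
  (forall i, p i -> f i x @[x --> F] --> f0 i) ->
  \sum_(i <- l | p i) f i x @[x --> F] --> \sum_(i <- l | p i) f0 i.
Proof. by apply: cvg_big; exact: add_continuous. Qed.

Lemma cvg_prodr (J I : Type) (F : set_system J) {FF : Filter F} (l : seq I)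
    (p : pred I) (f : I -> J -> R) (f0 : I -> R) :
  (forall i, p i -> f i x @[x --> F] --> f0 i) ->
  \prod_(i <- l | p i) f i x @[x --> F] --> \prod_(i <- l | p i) f0 i.
Proof. by apply: cvg_big; exact: mul_continuous. Qed.

Lemma cvg_box_sum (r K : nat) (g : nat -> R) (F : nat -> 'I_r -> R -> R)
    (F0 : 'I_r -> R -> R) (x : R) :
  (forall j i, F m j (g i) @[m --> \oo] --> F0 j (g i)) ->
  box_sum K g (F m) x @[m --> \oo] --> box_sum K g F0 x.
Proof.
move=> cF; rewrite /box_sum.
apply: cvg_sumr => c _; rewrite /box_weight.
by apply: cvg_prodr => j _; apply: cvgB.
Qed.

Lemma cvg_grid_y (dl : R) : 0 < dl -> grid n dl (2 * n).+1 @[n --> \oo] --> +oo.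
Proof.
move=> dl0; apply/cvgryPge => A; near=> n.
rewrite /grid; have -> : ((2 * n).+1%:R - n%:R - 2^-1 : R) = n%:R + 2^-1.
  by rewrite -natr1 natrM; field.
have An : A / dl <= n%:R by near: n; exact: nbhs_infty_ger.
by rewrite -ler_pdivrMr//; apply: (le_trans An); rewrite lerDl.
Unshelve. all: by end_near. Qed.

Lemma cvg_grid_Ny (dl : R) : 0 < dl -> grid n dl 0 @[n --> \oo] --> -oo.
Proof.
move=> dl0; apply/cvgrNyPle => A; near=> n.
rewrite /grid.
have An : - A / dl <= n%:R by near: n; exact: nbhs_infty_ger.
rewrite -ler_pdivlMr//; move: An; rewrite mulNr; lra.
Unshelve. all: by end_near. Qed.

(** The continuous mapping theorem for the median of independent coordinates.
    For a fixed grid the box sums of [X m] converge to those of [Z]; a fine grid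
    makes the shifts by the mesh harmless at a continuity point of the limit, and
    a long one makes the mass outside small. *)
Lemma median_rv_cvg (r : nat) (d : nat -> measure_display)
    (T : forall m, measurableType (d m)) (P : forall m, probability (T m) R)
    (X : forall m, 'I_r -> {RV (P m) >-> R})
    (d' : measure_display) (T' : measurableType d') (P' : probability T' R)
    (Z : 'I_r -> {RV P' >-> R}) (x : R) :
  (0 < r)%N ->
  (forall m, mutually_independent (P m) (X m)) -> mutually_independent P' Z ->
  (forall j y, y != 0 -> fine (cdf (X m j) y) @[m --> \oo] --> fine (cdf (Z j) y)) ->
  let G t := fine (P' [set w | median_rv Z w <= t]) in
  {for x, continuous G} ->
  fine (P m [set w | median_rv (X m) w <= x]) @[m --> \oo] --> G x.
Proof.
move=> r0 iX iZ cXZ G cG; apply/cvgrPdist_le => e e0.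
have e40 : 0 < e / 4 by rewrite divr_gt0.
have [dl dl0 [G1 G2]] : exists2 dl : R, 0 < dl &
    `|G x - G (x + dl)| <= e / 4 /\ `|G x - G (x - dl)| <= e / 4.
  move/cvgrPdist_le : cG => /(_ _ e40)/nbhs_ballP[d0 /= d00 h].
  have d20 : `|d0 / 2| < d0 by rewrite gtr0_norm ?divr_gt0//; lra.
  exists (d0 / 2); first by rewrite divr_gt0.
  split; apply: h; rewrite /ball/=.
    by rewrite opprD addNKr normrN.
  by rewrite opprB addrC subrK.
pose F j y := fine (cdf (Z j) y).
pose out n j := 1 - (F j (grid n dl (2 * n).+1) - F j (grid n dl 0)).
have [n outn] : exists n, \sum_(j < r) out n j <= e / 4.
  have : \sum_(j < r) out n j @[n --> \oo] --> (\sum_(j < r) (1 - (1 - 0)) : R).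
    apply: cvg_sumr => j _; apply: cvgB; first exact: cvg_cst.
    apply: cvgB.
      exact: (cvg_comp _ _ (cvg_grid_y dl0) (fine_cvg (cvg_cdfy1 (Z j)))).
    exact: (cvg_comp _ _ (cvg_grid_Ny dl0) (fine_cvg (cvg_cdfNy0 (Z j)))).
  rewrite big1 => [|j _]; last by rewrite subr0 subrr.
  move/cvgrPdist_le => /(_ _ e40) [n _ /(_ n (leqnn n))] /=.
  by rewrite sub0r normrN => h; exists n; exact: le_trans (ler_norm _) h.
pose g := grid n dl; pose K := (2 * n).+1.
have gS i : g i.+1 = g i + dl by exact: gridS.
have g_nd i : g i <= g i.+1 by rewrite gS lerDl ltW.
have cover y : g 0 < y <= g K -> exists i : 'I_K, g i < y <= g i.+1.
  by move=> /andP[]; exact: grid_cover.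
have gn0 i : g i != 0 by rewrite grid_neq0// gt_eqF.
pose FX m j y := fine (cdf (X m j) y).
have cg j i : FX m j (g i) @[m --> \oo] --> F j (g i) by exact: cXZ.
have c1 := @cvg_box_sum r K g FX F x cg.
have c2 := @cvg_box_sum r K g FX F (x - dl) cg.
have c3 : \sum_(j < r) (1 - (FX m j (g K) - FX m j (g 0))) @[m --> \oo]
    --> \sum_(j < r) out n j.
  by apply: cvg_sumr => j _; apply: cvgB; [exact: cvg_cst|apply: cvgB].
have zl : box_sum K g F x <= G (x + dl).
  by have := @box_lower _ r K g g_nd _ _ P' Z iZ dl (x + dl) r0 gS; rewrite addrK.
have zu : G (x - dl) <= box_sum K g F (x - dl) + \sum_(j < r) out n j.
  exact: (@box_upper _ r K g g_nd _ _ P' Z iZ (x - dl) cover).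
move/cvgrPdist_le : c1 => /(_ _ e40) N1.
move/cvgrPdist_le : c2 => /(_ _ e40) N2.
move/cvgrPdist_le : c3 => /(_ _ e40) N3.
apply: filterS3 N1 N2 N3 => m.
have := @box_lower _ r K g g_nd _ _ (P m) (X m) (iX m) dl x r0 gS.
have := @box_upper _ r K g g_nd _ _ (P m) (X m) (iX m) x cover.
rewrite -/(FX m) => u l.
set p := fine (P m _) in u l *.
move: u l zl zu outn G1 G2.
rewrite !ler_norml; lra.
Qed.

End median_limit.

(** * Existence of independent copies *)
Section iid.
Context {R : realType}.

(** Bundles the space, so that it can be built by induction on the number of
    variables: each new copy is a new factor of a product space. *)
Structure rv_family (r : nat) := RVFamily {
  rv_disp : measure_display ;
  rv_space : measurableType rv_disp ;
  rv_prob : probability rv_space R ;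
  rv_fun : 'I_r -> {RV rv_prob >-> R} }.

Section product_extension.
Context d1 d2 (T1 : measurableType d1) (T2 : measurableType d2)
  (P1 : probability T1 R) (P2 : probability T2 R).
Local Notation P12 := (P1 \x P2)%E.

Lemma product_fst (A : set T1) : measurable A -> P12 (fst @^-1` A) = P1 A.
Proof.
move=> mA; rewrite (_ : fst @^-1` A = A `*` setT); last first.
  by apply/seteqP; split => -[x y]//= [].
by rewrite product_measure1E// [X in (_ * X)%E]probability_setT mule1.
Qed.

Lemma product_snd (A : set T2) : measurable A -> P12 (snd @^-1` A) = P2 A.
Proof.
move=> mA; rewrite (_ : snd @^-1` A = setT `*` A); last first.
  by apply/seteqP; split => -[x y]//= [].
by rewrite product_measure1E// [X in (X * _)%E]probability_setT mul1e.
Qed.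

Context (r : nat) (Z : 'I_r -> {RV P1 >-> R}) (X : {RV P2 >-> R}).

Definition extend_fun (i : 'I_r.+1) : T1 * T2 -> R :=
  if unlift ord0 i is Some j then Z j \o fst else X \o snd.

Lemma measurable_extend_fun i : measurable_fun setT (extend_fun i).
Proof.
rewrite /extend_fun; case: (unlift ord0 i) => [j|]; exact: measurableT_comp.
Qed.

Definition extend_rv (i : 'I_r.+1) : {RV P12 >-> R} :=
  mfun_Sub (mem_set (measurable_extend_fun i)).

Lemma extend_rv0 A : measurable A -> P12 (extend_rv ord0 @^-1` A) = P2 (X @^-1` A).
Proof.
move=> mA; rewrite -product_snd; last exact: measurable_funPTI.
by rewrite /= /extend_fun unlift_none.
Qed.

Lemma extend_rv_lift j A : measurable A ->
  P12 (extend_rv (lift ord0 j) @^-1` A) = P1 (Z j @^-1` A).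
Proof.
move=> mA; rewrite -product_fst; last exact: measurable_funPTI.
by rewrite /= /extend_fun liftK.
Qed.

Lemma extend_rv_indep : mutually_independent P1 Z -> mutually_independent P12 extend_rv.
Proof.
move=> iZ J A mA.
pose J' : {set 'I_r} := [set j | lift ord0 j \in J]%SET.
pose B := \bigcap_(j in [set` J']) Z j @^-1` A (lift ord0 j).
pose C := if ord0 \in J then X @^-1` A ord0 else setT.
have -> : \bigcap_(i in [set` J]) extend_rv i @^-1` A i = B `*` C.
  apply/seteqP; split => -[w1 w2] h.
    split.
      move=> j /=; rewrite finset.inE => jJ.
      by have := h _ jJ; rewrite /= /extend_fun liftK.
    rewrite /C; case: ifPn => // J0.
    by have := h _ J0; rewrite /= /extend_fun unlift_none.
  move=> i /= iJ; rewrite /extend_fun; case: unliftP => [j|] ij.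
    by have := h.1 j; rewrite /= finset.inE -ij; apply.
  by have := h.2; rewrite /C -ij iJ.
have mB : measurable B.
  by apply: fin_bigcap_measurable => // j _; exact: measurable_funPTI.
have mC : measurable C by rewrite /C; case: ifPn => // _; exact: measurable_funPTI.
transitivity (P1 B * P2 C)%E; first exact: product_measure1E.
rewrite [X in (X * _)%E](iZ J' (fun j => A (lift ord0 j)))//.
rewrite [RHS]big_mkcond big_ord_recl muleC; congr (_ * _)%E.
  rewrite /C; case: ifPn => J0; first exact/esym/extend_rv0.
  by rewrite probability_setT.
rewrite big_mkcond; apply: eq_bigr => j _; rewrite finset.inE.
by case: ifPn => // _; exact/esym/extend_rv_lift.
Qed.

End product_extension.

Lemma iid_family_exists (d : measure_display) (T : measurableType d)
    (P : probability T R) (X : {RV P >-> R}) (r : nat) :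
  exists E : rv_family r, mutually_independent (rv_prob E) (@rv_fun r E) /\
    forall j A, measurable A ->
      distribution (rv_prob E) (rv_fun E j) A = distribution P X A.
Proof.
elim: r => [|r [E [iE lE]]].
  exists (@RVFamily 0 _ T P (fun=> X)); split => // J A mA.
  rewrite big1 => [|[]//]; rewrite (_ : \bigcap_(i in _) _ = setT).
    by rewrite probability_setT.
  by apply/seteqP; split => // w _ [].
exists (RVFamily (extend_rv (@rv_fun _ E) X)); split.
  exact: extend_rv_indep.
move=> /= i A mA; have [j ->|->] := unliftP ord0 i.
  by rewrite -(lE j)//; exact: extend_rv_lift.
exact: extend_rv0.
Qed.

Definition scaled_normal (V : R) : {RV normal_prob (0 : R) 1 >-> R} :=
  rescaled_rv (Num.sqrt V) 0 (normal_id : {RV normal_prob (0 : R) 1 >-> R}).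

Lemma cdf_scaled_normal (V y : R) : 0 <= V ->
  distribution (normal_prob 0 1) (scaled_normal V) `]-oo, y] = (normal_cdf V y)%:E.
Proof.
move=> V0; rewrite /distribution /pushforward /normal_cdf.
have [->|Vn0] := eqVneq V 0.
  have [y0|y0] := leP 0 y.
    rewrite (_ : _ @^-1` _ = setT); first by rewrite probability_setT.
    by apply/seteqP; split => // w _; rewrite /= in_itv/= /rescaled_rv sqrtr0 mul0r.
  rewrite (_ : _ @^-1` _ = set0); first by rewrite measure0.
  apply/seteqP; split => // w; rewrite /= in_itv/= /rescaled_rv sqrtr0 mul0r.
  by rewrite leNgt y0.
have s0 : 0 < Num.sqrt V by rewrite sqrtr_gt0 lt_def Vn0.
rewrite gauss_cdfE; congr (normal_prob 0 1 _).
apply/seteqP; split => w; rewrite /= !in_itv/= /rescaled_rv subr0 ler_pdivlMr// [w * _]mulrC; exact.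
Qed.

End iid.

(** * The central limit theorem for families of random variables *)
Section clt_families.
Context {R : realType}.

Lemma cvg_near_eq (I : Type) (F : set_system I) {FF : Filter F} (f g : I -> R)
    (l : R) : f @ F --> l -> (\forall i \near F, f i = g i) -> g @ F --> l.
Proof. by move=> fl fg; apply: cvg_trans fl; exact: near_eq_cvg. Qed.

(** Extends a finite family by zero, so that sums over [n] variables are partial
    sums of a sequence. *)
Definition nat_family n (T : Type) (Y : 'I_n -> T -> R) (i : nat) (w : T) : R :=
  if insub i is Some j then Y j w else 0.

Lemma nat_familyE n (T : Type) (Y : 'I_n -> T -> R) (j : 'I_n) :
  nat_family Y j = Y j.
Proof. by apply/funext => w; rewrite /nat_family valK. Qed.

Lemma nat_family_out n (T : Type) (Y : 'I_n -> T -> R) i : (n <= i)%N ->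
  nat_family Y i = cst 0.
Proof.
by move=> ni; apply/funext => w; rewrite /nat_family insubN// -leqNgt.
Qed.

Lemma partial_sum_nat_family n d (T : measurableType d)
    (Y : 'I_n -> T -> R) w :
  partial_sum (nat_family Y) n w = \sum_(j < n) Y j w.
Proof.
by rewrite /partial_sum big_mkord; apply: eq_bigr => j _; rewrite nat_familyE.
Qed.

Lemma nat_family_indep n d (T : measurableType d) (P : probability T R)
    (X : 'I_n -> {RV P >-> R}) (h : 'I_n -> R -> R) (A : nat -> set R) :
  (forall i, measurable_fun setT (h i)) -> mutually_independent P X ->
  (forall i, measurable (A i)) ->
  let Z := nat_family (fun i w => h i (X i w)) in
  P (\bigcap_(i in `I_n) Z i @^-1` A i) = (\prod_(0 <= i < n) P (Z i @^-1` A i))%E.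
Proof.
move=> mh iX mA Z.
have mhA (i : 'I_n) : measurable (h i @^-1` A i) by exact: measurable_preimage.
have := iX [set: 'I_n]%SET (fun i => h i @^-1` A i) mhA.
rewrite big_mkord => iXE; apply: etrans (etrans iXE _).
  congr (P _); apply/seteqP; split => w h1 i /= h2.
    by have := h1 i (ltn_ord i); rewrite /Z nat_familyE.
  have := h1 (Ordinal h2); rewrite /= finset.in_setT => /(_ isT).
  by rewrite /Z -[i]/(val (Ordinal h2)) nat_familyE.
rewrite (eq_bigl predT) => [|j]; last by rewrite finset.in_setT.
by apply: eq_bigr => j _; rewrite /Z nat_familyE.
Qed.

Theorem lyapunov_clt_indep (d : nat -> measure_display)
    (T : forall k, measurableType (d k)) (P : forall k, probability (T k) R)
    (n : nat -> nat) (X : forall k, 'I_(n k) -> {RV (P k) >-> R})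
    (h : forall k, 'I_(n k) -> R -> R) (V x : R) :
  (forall k, mutually_independent (P k) (X k)) ->
  (forall k i, bounded_rv (h k i)) ->
  (forall k i, \int[P k]_w h k i (X k i w) = 0) ->
  let v k i := \int[P k]_w h k i (X k i w) ^+ 2 in
  \sum_(i < n k) v k i @[k --> \oo] --> V ->
  \sum_(i < n k) (\int[P k]_w `|h k i (X k i w)| ^+ 3 + v k i ^+ 2)
    @[k --> \oo] --> (0 : R) ->
  V != 0 \/ x != 0 ->
  fine (P k [set w | \sum_(i < n k) h k i (X k i w) <= x]) @[k --> \oo]
    --> normal_cdf V x.
Proof.
move=> iX bh Eh v cV c0 Vx.
pose Z k := nat_family (fun i w => h k i (X k i w)).
have bZ k i : bounded_rv (Z k i).
  have [nk|kn] := leqP (n k) i; first by rewrite /Z nat_family_out//; exact: bounded_rv_cst.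
  by rewrite /Z -[i]/(val (Ordinal kn)) nat_familyE; exact: bounded_rv_comp.
have iZ k (A : nat -> set R) : (forall i, measurable (A i)) ->
    P k (\bigcap_(i in `I_(n k)) Z k i @^-1` A i)
    = (\prod_(0 <= i < n k) P k (Z k i @^-1` A i))%E.
  by move=> mA; apply: nat_family_indep => // i; case: (bh k i).
have EZ k i : \int[P k]_w Z k i w = 0.
  have [nk|kn] := leqP (n k) i.
    by rewrite /Z nat_family_out// expect_cst.
  by rewrite /Z -[i]/(val (Ordinal kn)) nat_familyE.
have /= := @lyapunov_clt R d T P n Z V x bZ iZ EZ.
have e1 : (fun k => \sum_(0 <= i < n k) \int[P k]_w Z k i w ^+ 2)
    = (fun k => \sum_(i < n k) v k i).
  apply/funext => k; rewrite big_mkord; apply: eq_bigr => i _.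
  by rewrite /Z nat_familyE.
have e2 : (fun k => \sum_(0 <= i < n k) (\int[P k]_w `|Z k i w| ^+ 3 + (\int[P k]_w Z k i w ^+ 2) ^+ 2))
    = (fun k => \sum_(i < n k) (\int[P k]_w `|h k i (X k i w)| ^+ 3 + v k i ^+ 2)).
  apply/funext => k; rewrite big_mkord; apply: eq_bigr => i _.
  by rewrite /Z nat_familyE.
have e3 : (fun k => fine (P k [set w | partial_sum (Z k) (n k) w <= x]))
    = (fun k => fine (P k [set w | \sum_(i < n k) h k i (X k i w) <= x])).
  apply/funext => k; congr (fine (P k _)); apply/seteqP.
  by split => w; rewrite /= partial_sum_nat_family.
by rewrite e1 e2 e3; apply.
Qed.

End clt_families.

(** * Medians of many normal variables *)
Section median_of_normals.
Context {R : realType}.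

Lemma count_le_sum r (f : 'I_r -> R) (x : R) :
  (count (fun z => (z <= x)%R) [seq f j | j <- enum 'I_r])%:R
  = \sum_(j < r) (f j <= x)%R%:R :> R.
Proof.
rewrite count_map -sum1_count big_mkcond/= big_enum/= natr_sum.
by apply: eq_bigr => j _; case: ifPn.
Qed.

(** A difference quotient of [gauss_cdf] at 0, with step [y / sqrt r]. *)
Lemma sqrt_mul_gauss_cdf_cvg (y : R) :
  Num.sqrt r%:R * (gauss_cdf (y / Num.sqrt r%:R) - 2^-1) @[r --> \oo]
    --> normal_pdf 0 1 0 * y.
Proof.
have [K K0 HK] := @gauss_cdf_taylor R.
have cK : K * `|y| ^+ 3 * (r%:R)^-1 @[r --> \oo] --> (0 : R).
  rewrite -[X in _ --> X](mulr0 (K * `|y| ^+ 3)); apply: cvgM; first exact: cvg_cst.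
  apply/gtr0_cvgV0; last exact: cvgr_idn.
  by near=> r; rewrite ltr0n; near: r; exact: nbhs_infty_gt.
apply/cvgrPdist_le => e e0.
move/cvgrPdist_le : cK => /(_ _ e0).
apply: filterS2 (nbhs_infty_gt 0) => r r0.
rewrite sub0r normrN => h.
have r0' : (0 : R) < r%:R by rewrite ltr0n.
have s0 : 0 < Num.sqrt r%:R :> R by rewrite sqrtr_gt0.
have sr : r%:R = Num.sqrt r%:R ^+ 2 :> R by rewrite sqr_sqrtr ?ltW.
apply: le_trans (le_trans (ler_norm _) h).
have := HK 0 (y / Num.sqrt r%:R).
rewrite add0r gauss_cdf0 mul0r mulr0 mul0r addr0 => h2.
rewrite distrC.
rewrite (_ : _ - _ = Num.sqrt r%:R * (gauss_cdf (y / Num.sqrt r%:R) - 2^-1 -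
  normal_pdf 0 1 0 * (y / Num.sqrt r%:R))); last by field; rewrite gt_eqF.
rewrite normrM (gtr0_norm s0).
apply: (le_trans (ler_wpM2l (ltW s0) h2)).
rewrite normrM normfV (gtr0_norm s0) le_eqVlt; apply/orP; left; apply/eqP.
by rewrite [in RHS]sr; field; rewrite gt_eqF.
Unshelve. all: by end_near. Qed.

(** Up to a tie, the median is at most [x] if and only if at least half of the [r]
    values are.  Each value has variance [r * s2], hence is at most [x] with
    probability [p r = gauss_cdf (y / sqrt r)] where [y = x / sqrt s2].  The
    normalized count satisfies the central limit theorem with variance 1/4,
    while [sqrt r * (p r - 1 / 2)] tends to [c = normal_pdf 0 1 0 * y]; so the limit
    is [gauss_cdf (2 * c)], and [2 * c = x / sqrt (pi * s2 / 2)]. *)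
Lemma median_normal_cvg (s2 x : R) (d : nat -> measure_display)
    (T : forall r, measurableType (d r)) (P : forall r, probability (T r) R)
    (Z : forall r, 'I_r -> {RV (P r) >-> R}) : 0 < s2 ->
  (forall r, mutually_independent (P r) (Z r)) ->
  (forall r j y, fine (cdf (Z r j) y) = normal_cdf (r%:R * s2) y) ->
  fine (P r [set w | median_rv (Z r) w <= x]) @[r --> \oo]
    --> normal_cdf (pi * s2 / 2) x.
Proof.
move=> s20 iZ cZ.
have s0 : 0 < Num.sqrt s2 by rewrite sqrtr_gt0.
pose y := x / Num.sqrt s2.
pose p r : R := normal_cdf (r%:R * s2) x.
have p01 r : 0 <= p r <= 1.
  rewrite /p /normal_cdf; case: ifPn => _; first by case: (0 <= x); rewrite ?lexx ?ler01.
  by rewrite gauss_cdf_ge0 gauss_cdf_le1.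
have pE r : (0 < r)%N -> p r = gauss_cdf (y / Num.sqrt r%:R).
  move=> r0; have r0' : (0 : R) < r%:R by rewrite ltr0n.
  rewrite /p /normal_cdf gt_eqF ?mulr_gt0// sqrtrM ?ler0n// /y.
  by rewrite invfM mulrA mulrAC.
(* the sign makes a large count correspond to a small sum *)
pose h r (j : 'I_r) (z : R) := (p r - (z <= x)%R%:R) / Num.sqrt r%:R.
have bI r : bounded_rv (fun z : R => p r - (z <= x)%R%:R).
  apply: bounded_rvB; first exact: (bounded_rv_cst _ (p r)).
  have := @bounded_rv_indic R _ R `]-oo, x] (measurable_itv _).
  congr bounded_rv; apply/funext => z; rewrite indicE; congr (_%:R).
  by rewrite mem_setE in_itv.
have bh r j : bounded_rv (h r j).
  have := bounded_rvZ (Num.sqrt r%:R)^-1 (bI r).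
  by rewrite /h; under [X in _ -> bounded_rv X]eq_fun do rewrite mulrC.
have bZ r j := bounded_rv_comp (@measurable_funPT _ _ _ _ (Z r j)) (bh r j).
have Ip r (j : 'I_r) : \int[P r]_w (Z r j w <= x)%R%:R = p r.
  rewrite -[RHS](cZ r j) /cdf /distribution /pushforward.
  rewrite -expect_indic; last exact: measurable_funPTI.
  apply: eq_Rintegral => w _; rewrite indicE; congr (nat_of_bool _)%:R.
  by apply/idP/idP; rewrite inE/= in_itv.
have bIZ r (j : 'I_r) : bounded_rv (fun w => (Z r j w <= x)%R%:R : R).
  have := bounded_rvB (bounded_rv_cst _ (p r)) (bounded_rv_comp (@measurable_funPT _ _ _ _ (Z r j)) (bI r)).
  by congr bounded_rv; apply/funext => w; rewrite /= opprB addrC subrK.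
have Eh r j : \int[P r]_w h r j (Z r j w) = 0.
  rewrite /h; under eq_Rintegral do rewrite mulrC.
  rewrite expectZ; last exact: (bounded_rv_comp (@measurable_funPT _ _ _ _ (Z r j)) (bI r)).
  rewrite expectB//; last exact: (bounded_rv_cst _ (p r)).
  by rewrite Ip expect_cst subrr mulr0.
pose v r j := \int[P r]_w h r j (Z r j w) ^+ 2.
have vE r j : v r j = p r * (1 - p r) / r%:R.
  have hE w : h r j (Z r j w) ^+ 2 =
      r%:R^-1 * (p r ^+ 2 + (1 - 2 * p r) * (Z r j w <= x)%R%:R).
    rewrite /h expr_div_n sqr_sqrtr ?ler0n// mulrC; congr (_ * _).
    by case: (Z r j w <= x) => /=; ring.
  rewrite /v; under eq_Rintegral do rewrite hE.
  have b1 := bounded_rvZ (1 - 2 * p r) (bIZ r j).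
  rewrite expectZ; last by apply: bounded_rvD => //; exact: (bounded_rv_cst _ (p r ^+ 2)).
  rewrite expectD//; last exact: (bounded_rv_cst _ (p r ^+ 2)).
  by rewrite expect_cst expectZ// Ip; ring.
have cp : p r @[r --> \oo] --> (2^-1 : R).
  rewrite -(@gauss_cdf0 R).
  have c0 : y / Num.sqrt r%:R @[r --> \oo] --> (0 : R).
    rewrite -[X in _ --> X](mulr0 y); apply: cvgM; first exact: cvg_cst.
    rewrite -[X in _ --> X](@sqrtr0 R).
    have : Num.sqrt (r%:R^-1) @[r --> \oo] --> Num.sqrt (0 : R).
      apply: cvg_sqrt; apply/gtr0_cvgV0; last exact: cvgr_idn.
      by near=> r; rewrite ltr0n; near: r; exact: nbhs_infty_gt.
    by under eq_cvg do rewrite sqrtrV ?ler0n//.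
  apply: (cvg_near_eq (cvg_gauss_cdf c0)).
  by near=> r; rewrite pE//; near: r; exact: nbhs_infty_gt.
have cV : \sum_(j < r) v r j @[r --> \oo] --> (4^-1 : R).
  have : p r * (1 - p r) @[r --> \oo] --> (2^-1 * (1 - 2^-1) : R).
    by apply: cvgM => //; apply: cvgB => //; exact: cvg_cst.
  rewrite (_ : 2^-1 * (1 - 2^-1) = 4^-1 :> R); last by field.
  move/cvg_near_eq; apply; near=> r.
  under eq_bigr do rewrite vE.
  rewrite sumr_const card_ord -[RHS]mulr_natr divfK//.
  by rewrite pnatr_eq0 -lt0n; near: r; exact: nbhs_infty_gt.
have hb r j w : `|h r j (Z r j w)| <= (Num.sqrt r%:R)^-1.
  rewrite /h normrM [X in _ * X]ger0_norm ?invr_ge0 ?sqrtr_ge0//.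
  rewrite ler_piMl ?invr_ge0 ?sqrtr_ge0//.
  by have := p01 r; case: (Z r j w <= x) => /= p1; rewrite ler_norml; lra.
have c0 : \sum_(j < r) (\int[P r]_w `|h r j (Z r j w)| ^+ 3 + v r j ^+ 2)
    @[r --> \oo] --> (0 : R).
  apply: (@squeeze_cvgr _ _ _ _ (cst 0) (fun r => (Num.sqrt r%:R)^-1 + r%:R^-1)); last 2 first.
  - exact: cvg_cst.
  - rewrite -[X in _ --> X](addr0 0); apply: cvgD.
      rewrite -[X in _ --> X](@sqrtr0 R).
      have : Num.sqrt (r%:R^-1) @[r --> \oo] --> Num.sqrt (0 : R).
        apply: cvg_sqrt; apply/gtr0_cvgV0; last exact: cvgr_idn.
        by near=> r; rewrite ltr0n; near: r; exact: nbhs_infty_gt.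
      by under eq_cvg do rewrite sqrtrV ?ler0n//.
    apply/gtr0_cvgV0; last exact: cvgr_idn.
    by near=> r; rewrite ltr0n; near: r; exact: nbhs_infty_gt.
  near=> r; have r0 : (0 : R) < r%:R.
    by rewrite ltr0n; near: r; exact: nbhs_infty_gt.
  have sr0 : 0 < Num.sqrt r%:R :> R by rewrite sqrtr_gt0.
  apply/andP; split.
    apply: sumr_ge0 => j _; rewrite addr_ge0 ?sqr_ge0//.
    by apply: Rintegral_ge0 => w _; rewrite exprn_ge0.
  apply: (@le_trans _ _ (\sum_(j < r) ((Num.sqrt r%:R)^-1 ^+ 3 + r%:R^-1 ^+ 2))).
    apply: ler_sum => j _; apply: lerD.
      rewrite -[leRHS](expect_cst (P r)); apply: expect_le.
      - exact/bounded_rvX/bounded_rv_norm.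
      - exact: (bounded_rv_cst _ ((Num.sqrt r%:R)^-1 ^+ 3)).
      - by move=> w; rewrite lerXn2r ?nnegrE ?invr_ge0 ?sqrtr_ge0.
    have := p01 r => /andP[p0 p1].
    have pp : 0 <= p r * (1 - p r) <= 1.
      by rewrite mulr_ge0 ?subr_ge0//=; nra.
    rewrite vE lerXn2r ?nnegrE ?invr_ge0 ?divr_ge0 ?(ltW r0)//; first by case/andP: pp.
    by rewrite ler_piMl ?invr_ge0 ?(ltW r0)//; case/andP: pp.
  rewrite sumr_const card_ord -[leLHS]mulr_natr mulrDl lerD//.
    have sE : r%:R = Num.sqrt r%:R ^+ 2 :> R by rewrite sqr_sqrtr ?ltW.
    rewrite le_eqVlt; apply/orP; left; apply/eqP.
    by rewrite [X in _ * X]sE; field; rewrite gt_eqF.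
  by rewrite le_eqVlt; apply/orP; left; apply/eqP; field; rewrite gt_eqF.
have CLT c : fine (P r [set w | \sum_(j < r) h r j (Z r j w) <= c]) @[r --> \oo]
    --> gauss_cdf (2 * c).
  have := @lyapunov_clt_indep R d T P id Z h 4^-1 c iZ bh Eh cV c0.
  rewrite /normal_cdf; have -> : (4^-1 == 0 :> R) = false by apply/negbTE; rewrite invr_neq0.
  have -> : Num.sqrt (4^-1) = 2^-1 :> R.
    rewrite (_ : 4^-1 = 2^-1 ^+ 2); last by field.
    by rewrite sqrtr_sqr ger0_norm.
  by rewrite invrK [c * 2]mulrC; apply; left.
pose c := normal_pdf 0 1 0 * y.
have limE : normal_cdf (pi * s2 / 2) x = gauss_cdf (2 * c).
  have ps0 : 0 < pi * s2 / 2 :> R by rewrite divr_gt0// mulr_gt0// pi_gt0.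
  rewrite /normal_cdf gt_eqF//; congr gauss_cdf.
  rewrite /c normal_pdf01E expr0n/= mul0r oppr0 expR0 mulr1 /normal_peak expr1n mul1r.
  have -> : Num.sqrt (pi *+ 2) = Num.sqrt pi * Num.sqrt 2 :> R.
    by rewrite -[pi *+ 2]mulr_natr sqrtrM ?pi_ge0.
  have -> : Num.sqrt (pi * s2 / 2) = Num.sqrt pi * Num.sqrt s2 / Num.sqrt 2 :> R.
    by rewrite sqrtrM ?mulr_ge0 ?pi_ge0 ?(ltW s20)// sqrtrM ?pi_ge0// sqrtrV.
  rewrite /y.
  have q2 : Num.sqrt 2 ^+ 2 = 2 :> R by rewrite sqr_sqrtr.
  have sq2 : Num.sqrt 2 != 0 :> R by rewrite gt_eqF// sqrtr_gt0.
  have sqp : Num.sqrt pi != 0 :> R by rewrite gt_eqF// sqrtr_gt0 pi_gt0.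
  rewrite -[X in _ = X * _]q2; field.
  by rewrite sq2 sqp gt_eqF.
have cc : Num.sqrt r%:R * (p r - 2^-1) @[r --> \oo] --> c.
  have H := @sqrt_mul_gauss_cdf_cvg y.
  refine (cvg_near_eq H _).
  by near=> r; rewrite pE//; near: r; exact: nbhs_infty_gt.
pose S r w := \sum_(j < r) h r j (Z r j w).
have SE r w : (0 < r)%N -> Num.sqrt r%:R * (S r w) =
    r%:R * p r - (count (fun z => (z <= x)%R) [seq Z r j w | j <- enum 'I_r])%:R.
  move=> r0; rewrite count_le_sum /S /h -mulr_suml sumrB sumr_const card_ord.
  rewrite [X in _ = X - _]mulr_natl mulrCA divff ?mulr1//.
  by rewrite gt_eqF// sqrtr_gt0 ltr0n.
have mS r t : measurable [set w | S r w <= t].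
  rewrite (_ : [set _ | _] = S r @^-1` `]-oo, t]).
    by apply: measurable_preimage => //; case: (bounded_rv_sum (bZ r)).
  by apply/seteqP; split => w /=; rewrite in_itv.
have mM r : measurable [set w | median_rv (Z r) w <= x].
  rewrite (_ : [set _ | _] = median_rv (Z r) @^-1` `]-oo, x]); first exact: measurable_funPTI.
  by apply/seteqP; split => w /=; rewrite in_itv.
have Ple r (A B : set (T r)) : measurable A -> measurable B -> A `<=` B ->
    fine (P r A) <= fine (P r B).
  by move=> mA mB AB; rewrite fine_le ?fin_num_measure// le_measure ?inE.
have up r t : (0 < r)%N -> Num.sqrt r%:R * (p r - 2^-1) <= t ->
    fine (P r [set w | median_rv (Z r) w <= x]) <= fine (P r [set w | S r w <= t]).
  move=> r0 ct; have r0' : (0 : R) < r%:R by rewrite ltr0n.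
  have sr0 : 0 < Num.sqrt r%:R :> R by rewrite sqrtr_gt0.
  apply: Ple => // w /= mx; apply: le_trans ct.
  rewrite -(ler_pM2l sr0) SE// mulrA -expr2 sqr_sqrtr ?(ltW r0')//.
  have := @count_median_le _ [seq Z r j w | j <- enum 'I_r] x.
  rewrite size_map size_enum_ord => /(_ r0 mx); rewrite -(ler_nat R) natrM; lra.
have lo r t : (0 < r)%N -> t < Num.sqrt r%:R * (p r - 2^-1) ->
    fine (P r [set w | S r w <= t]) <= fine (P r [set w | median_rv (Z r) w <= x]).
  move=> r0 ct; have r0' : (0 : R) < r%:R by rewrite ltr0n.
  have sr0 : 0 < Num.sqrt r%:R :> R by rewrite sqrtr_gt0.
  apply: Ple => // w /= St; apply: median_le_count.
  have := le_lt_trans St ct.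
  rewrite -(ltr_pM2l sr0) SE// mulrA -expr2 sqr_sqrtr ?(ltW r0')//.
  rewrite size_map size_enum_ord -(ltr_nat R) natrM; lra.
(* c is a limit only, so the threshold is enlarged and reduced by a small t *)
rewrite limE; apply/cvgrPdist_le => e e0.
have e20 : 0 < e / 2 by rewrite divr_gt0.
have [t t0 [G1 G2]] : exists2 t : R, 0 < t &
    `|gauss_cdf (2 * c) - gauss_cdf (2 * (c + t))| <= e / 2 /\
    `|gauss_cdf (2 * c) - gauss_cdf (2 * (c - t))| <= e / 2.
  have /cvgrPdist_le/(_ _ e20)/nbhs_ballP[d0 /= d00 hd] := @continuous_gauss_cdf R (2 * c).
  have d40 : `|2 * (d0 / 4)| < d0 by rewrite gtr0_norm ?mulr_gt0 ?divr_gt0//; lra.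
  exists (d0 / 4); first by rewrite divr_gt0.
  split; apply: hd; rewrite /ball/=.
    by rewrite -mulrBr opprD addNKr mulrN normrN.
  by rewrite -mulrBr opprB addrC subrK.
move/cvgrPdist_lt : cc => /(_ _ t0) N1.
have /cvgrPdist_le/(_ _ e20) N2 := CLT (c + t).
have /cvgrPdist_le/(_ _ e20) N3 := CLT (c - t).
have N4 : \forall r \near \oo, (0 < r)%N by exact: nbhs_infty_gt.
apply: filterS3 (filterI N4 N1) N2 N3 => r [r0 n1] n2 n3.
have u1 : Num.sqrt r%:R * (p r - 2^-1) <= c + t.
  by move: n1; rewrite ltr_norml; lra.
have l1 : c - t < Num.sqrt r%:R * (p r - 2^-1).
  by move: n1; rewrite ltr_norml; lra.
have := up r _ r0 u1; have := lo r _ r0 l1.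
move: n2 n3 G1 G2; rewrite /S !ler_norml; lra.
Unshelve. all: by end_near. Qed.

End median_of_normals.

(** * Uniformly distributed variables *)
Section uniform_expectation.
Context {R : realType}.
Local Notation leb := (@lebesgue_measure R).

Lemma bounded_rv_integrable_itv (h : R -> R) (a b : R) : bounded_rv h ->
  leb.-integrable `[a, b] (EFin \o h).
Proof.
move=> [mh [M hM]]; apply: measurable_bounded_integrable => //.
- by rewrite /= lebesgue_measure_itv/=; case: ifPn => _; rewrite -?EFinB ltry.
- exact: measurable_funTS.
- exists M; split; first exact: num_real.
  by move=> x Mx w _; apply: (le_trans (hM w)); exact: ltW.
Qed.

Context d (T : measurableType d) (P : probability T R).
Context (X : {RV P >-> R}) (a b : R).
Hypothesis unifX : uniformly_distributed P X a b.

Let ab : a < b. Proof. by case: unifX. Qed.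

(** The law of [X] is compared with [uniform_prob] on nonnegative functions,
    after which a bounded function is made nonnegative by adding a constant. *)
Lemma expect_uniform (h : R -> R) : bounded_rv h ->
  \int[P]_w h (X w) = (b - a)^-1 * \int[leb]_(x in `[a, b]) h x.
Proof.
case: unifX => ab' lawX.
have mX' : @measurable_fun _ _ T (measurableTypeR R) setT X.
  exact: (@measurable_funPT _ _ _ _ X).
pose X' : {mfun T >-> measurableTypeR R} :=
  @mfun_Sub _ _ T (measurableTypeR R) X (mem_set mX').
have nonneg (k : R -> R) : bounded_rv k -> (forall x, 0 <= k x) ->
    \int[P]_w k (X w) = (b - a)^-1 * \int[leb]_(x in `[a, b]) k x.
  move=> bk k0.
  have mk : measurable_fun setT (EFin \o k : measurableTypeR R -> \bar R).
    by apply/measurable_EFinP; case: bk.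
  rewrite /Rintegral.
  have -> : (\int[P]_w (k (X w))%:E = \int[uniform_prob ab']_y (k y)%:E)%E.
    transitivity (\int[distribution P X']_y (k y)%:E)%E.
      by rewrite ge0_integral_distribution.
    by apply: eq_measure_integral => A mA _; exact: lawX.
  rewrite integral_uniform//.
  rewrite fineM//; apply: integrable_fin_num => //.
  exact: bounded_rv_integrable_itv.
move=> bh; have [mh [M hM]] := bh.
have bM : bounded_rv (cst `|M| : R -> R) by exact: bounded_rv_cst.
have mXT : measurable_fun setT X by exact: measurable_funPT.
have := nonneg _ (bounded_rvD bh bM).
rewrite expectD; [|exact: bounded_rv_comp|exact: (bounded_rv_cst _ `|M|)].
rewrite RintegralD//; [|exact: bounded_rv_integrable_itv|exact: bounded_rv_integrable_itv].
have -> : \int[P]_w cst `|M| (X w) = `|M| by exact: expect_cst.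
have -> : \int[leb]_(x in `[a, b]) cst `|M| x = `|M| * (b - a).
  by rewrite Rintegral_cst//= lebesgue_measure_itv/= lte_fin ab.
rewrite mulrDr [_^-1 * (_ * _)]mulrC mulfK ?gt_eqF ?subr_gt0// => H.
apply: (@addIr _ `|M|); apply: H => x.
by have := hM x; have := ler_norm M; rewrite ler_norml /=; lra.
Qed.

Lemma expect_uniform_le (h k : R -> R) : bounded_rv h -> bounded_rv k ->
  (forall x, a <= x <= b -> h x <= k x) ->
  \int[P]_w h (X w) <= \int[P]_w k (X w).
Proof.
move=> bh bk hk; rewrite !expect_uniform// ler_pM2l ?invr_gt0 ?subr_gt0//.
apply: le_Rintegral => //.
- exact: bounded_rv_integrable_itv.
- exact: bounded_rv_integrable_itv.
Qed.

Lemma expect_uniform_norm_le (h : R -> R) (M : R) : bounded_rv h ->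
  (forall x, a <= x <= b -> `|h x| <= M) -> `|\int[P]_w h (X w)| <= M.
Proof.
move=> bh hM; have bM (c : R) : bounded_rv (cst c : R -> R) by exact: bounded_rv_cst.
rewrite ler_norml; apply/andP; split.
  rewrite -[leLHS](expect_cst P); apply: (expect_uniform_le (bM (- M)) bh) => x /hM.
  by rewrite ler_norml => /andP[].
rewrite -[leRHS](expect_cst P); apply: (expect_uniform_le bh (bM M)) => x /hM.
by rewrite ler_norml => /andP[].
Qed.

(** Cut off to be bounded on the whole line, as [bounded_rv] requires. *)
Definition centered_id (x : R) : R := ((fun x => x - (a + b) / 2) \_ `[a, b]) x.

Lemma bounded_rv_centered_id : bounded_rv centered_id.
Proof.
split.
  apply/(measurable_restrictT _ _).1 => //; apply: measurable_funTS.
  exact: measurable_funB.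
exists (b - a) => x; rewrite /centered_id patchE; case: ifPn; last first.
  by rewrite normr0 subr_ge0 ltW.
by rewrite inE/= in_itv/= ler_norml; have := ab; lra.
Qed.

Lemma centered_idE x : a <= x <= b -> centered_id x = x - (a + b) / 2.
Proof. by move=> xab; rewrite /centered_id patchE mem_set//= in_itv. Qed.

Lemma centered_id_norm_le x : a <= x <= b -> `|centered_id x| <= b - a.
Proof. by move=> xab; rewrite centered_idE// ler_norml; lra. Qed.

(** The fundamental theorem of calculus for the primitive
    [(x - (a + b) / 2) ^+ n.+1 / n.+1]. *)
Lemma expect_centered_id n : \int[P]_w centered_id (X w) ^+ n =
  ((b - a) / 2) ^+ n.+1 * (1 - (- 1) ^+ n.+1) / ((b - a) * n.+1%:R).
Proof.
rewrite (expect_uniform (bounded_rvX n bounded_rv_centered_id)).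
have -> : \int[leb]_(x in `[a, b]) centered_id x ^+ n
    = \int[leb]_(x in `[a, b]) (x - (a + b) / 2) ^+ n.
  by apply: eq_Rintegral => x; rewrite inE/= in_itv/= => xab; rewrite centered_idE.
pose F (x : R) := n.+1%:R^-1 * (x - (a + b) / 2) ^+ n.+1.
have dF (x : R) : is_derive x 1 F ((x - (a + b) / 2) ^+ n).
  have H1 := is_deriveB (is_derive_id x (1 : R)) (is_derive_cst ((a + b) / 2) x (1 : R)).
  have H := is_deriveZ (n.+1%:R^-1) (is_deriveX n.+1 H1).
  apply: (is_derive_congr H) => [y|]; first by rewrite /F /= !fctE.
  rewrite /= !fctE /GRing.scale/= subr0 mulr1 mulrA mulVf ?mul1r//.
have cF : continuous F by exact: (derivable_cvg_continuous dF).
have cX : continuous (fun x : R => (x - (a + b) / 2) ^+ n).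
  move=> x; apply: (@continuous_comp _ _ _ (fun x => x - (a + b) / 2) (fun y => y ^+ n)); last exact: exprn_continuous.
  by apply: cvgB; [exact: cvg_id|exact: cvg_cst].
rewrite /Rintegral (continuous_FTC2 ab (F := F)); first last.
- by move=> x _; rewrite derive1E derive_val.
- split.
  + by move=> x _; have [] := dF x.
  + exact/cvg_at_right_filter/cF.
  + exact/cvg_at_left_filter/cF.
- exact: continuous_subspaceT.
rewrite /F -EFinB /=.
have -> : b - (a + b) / 2 = (b - a) / 2 by field.
have -> : a - (a + b) / 2 = - 1 * ((b - a) / 2) by field.
have k0 : n.+1%:R != 0 :> R by rewrite pnatr_eq0.
have l0 : b - a != 0 by rewrite subr_eq0 gt_eqF.
rewrite [(- 1 * _) ^+ _]exprMn; move: (((b - a) / 2) ^+ n.+1) ((- 1) ^+ n.+1 : R) => u v.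
move: (n.+1%:R : R) k0 => k k0; field.
by rewrite k0 l0.
Qed.

Lemma expect_centered_id1 : \int[P]_w centered_id (X w) = 0.
Proof.
have := expect_centered_id 1; rewrite sqrrN expr1n subrr mulr0 mul0r => E.
by rewrite -[RHS]E; under [RHS]eq_Rintegral do rewrite expr1.
Qed.

Lemma expect_centered_id2 : \int[P]_w centered_id (X w) ^+ 2 = (b - a) ^+ 2 / 12.
Proof.
rewrite expect_centered_id; field.
by rewrite subr_eq0 gt_eqF.
Qed.

End uniform_expectation.

(** * Integrands with a Hoelder continuous derivative *)
Section smooth_integrand.
Context {R : realType} (f f' : R -> R) (beta C : R).
Hypothesis hbeta : 0 < beta <= 1.
Hypothesis hC : 0 <= C.
Hypothesis hderiv : has_derivative_on `[0, 1] f f'.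
Hypothesis hholder : holder_on `[0, 1] f' C beta.

Lemma difference_quotient (x e : R) : 0 <= x <= 1 -> 0 < e ->
  exists2 dl : R, 0 < dl & forall y, 0 <= y <= 1 -> y != x -> `|y - x| < dl ->
    `|f y - f x - f' x * (y - x)| <= e * `|y - x|.
Proof.
move=> x01 e0; have Ax : `[0, 1]%classic x by rewrite /= in_itv.
have /cvgrPdist_lt/(_ _ e0) := hderiv Ax.
rewrite !near_withinE => -[dl /= dl0 H]; exists dl => // y y01 yx yd.
have yx0 : y - x != 0 by rewrite subr_eq0.
have ny : 0 < `|y - x| by rewrite normr_gt0.
have := H y; rewrite /ball/= distrC => /(_ yd yx).
rewrite in_itv/= => /(_ y01) /ltW h.
rewrite -ler_pdivrMr// -normfV -normrM mulrBl mulfK// distrC; exact: h.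
Qed.

Lemma is_derive_interior (x : R) : 0 < x < 1 -> is_derive x 1 f (f' x).
Proof.
move=> /andP[x0 x1].
have H : (fun h : R => h^-1 *: ((f \o shift x) (h *: (1 : R)) - f x)) @ 0^' --> f' x.
  apply/cvgrPdist_le => e e0.
  have x01 : 0 <= x <= 1 by rewrite !ltW.
  have [dl dl0 Hd] := difference_quotient x01 e0.
  have m0 : 0 < Num.min dl (Num.min x (1 - x)) by rewrite !lt_min dl0 x0 subr_gt0.
  rewrite near_withinE; exists (Num.min dl (Num.min x (1 - x))) => //= h.
  rewrite /ball/= sub0r normrN !lt_min => /and3P[hdl hx h1x] h0.
  have hx1 : 0 <= h + x <= 1.
    by move: hx h1x; rewrite !ltr_norml; lra.
  have hxx : h + x != x by rewrite -subr_eq0 addrK.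
  have := Hd (h + x) hx1 hxx; rewrite addrK => /(_ hdl) h2.
  have nh : 0 < `|h| by rewrite normr_gt0.
  rewrite /= /shift /= /GRing.scale/= mulr1 -(ler_pM2r nh) -normrM.
  rewrite (_ : _ * h = - (f (h + x) - f x - f' x * h)) ?normrN//.
  by field.
apply: DeriveDef; first exact: (cvgP _ H).
exact: (cvg_lim _ H).
Qed.

Lemma integrand_continuous : {within `[0, 1], continuous f}.
Proof.
apply/subspace_continuousP => x; rewrite /= in_itv/= => x01.
have [dl dl0 Hd] := difference_quotient x01 ltr01.
have k0 : 0 < `|f' x| + 1 by rewrite ltr_wpDl.
apply/cvgrPdist_le => e e0; rewrite near_withinE.
have m0 : 0 < Num.min dl (e / (`|f' x| + 1)) by rewrite lt_min dl0 divr_gt0.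
exists (Num.min dl (e / (`|f' x| + 1))) => //= y.
rewrite /ball/= lt_min distrC => /andP[ydl ye]; rewrite in_itv/= => y01.
have [->|yx] := eqVneq y x; first by rewrite subrr normr0 ltW.
have := Hd y y01 yx ydl; rewrite mul1r => h.
rewrite distrC; apply: (@le_trans _ _ ((`|f' x| + 1) * `|y - x|)).
  rewrite mulrDl mul1r -normrM.
  have := ler_normD (f y - f x - f' x * (y - x)) (f' x * (y - x)).
  by rewrite subrK => /le_trans; apply; rewrite addrC lerD2l.
by rewrite -ler_pdivlMl// mulrC ltW.
Qed.

Lemma powR_le1 (x : R) : 0 <= x <= 1 -> x `^ beta <= 1.
Proof.
move=> /andP[x0 x1]; have <- : 1 `^ beta = 1 :> R by rewrite powR1.
rewrite ge0_ler_powR ?nnegrE//.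
by case/andP: hbeta => /ltW.
Qed.

(** A bound for [f'] on the unit interval, by comparison with the value at 0. *)
Definition deriv_bound : R := `|f' 0| + C.

Lemma deriv_bound_ge0 : 0 <= deriv_bound.
Proof. by rewrite addr_ge0. Qed.

Lemma deriv_norm_le (x : R) : 0 <= x <= 1 -> `|f' x| <= deriv_bound.
Proof.
move=> x01; have A0 : `[0, 1]%classic (0 : R) by rewrite /= in_itv/= lexx ler01.
have Ax : `[0, 1]%classic x by rewrite /= in_itv.
have h := hholder Ax A0; rewrite subr0 in h.
have := ler_normD (f' x - f' 0) (f' 0); rewrite subrK => /le_trans; apply.
rewrite addrC lerD2l (le_trans h)// ler_piMr// powR_le1//.
by have /andP[x0 ?] := x01; rewrite ger0_norm.
Qed.

Lemma deriv_close (x y l : R) : 0 <= x <= 1 -> 0 <= y <= 1 -> `|x - y| <= l ->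
  `|f' x - f' y| <= C * l `^ beta.
Proof.
move=> x01 y01 xyl; apply: (le_trans (hholder _ _)); rewrite /= ?in_itv//.
rewrite ler_wpM2l// ge0_ler_powR ?nnegrE//; first by case/andP: hbeta => /ltW.
exact: le_trans xyl.
Qed.

Lemma integrand_mean_value (a x : R) : 0 <= a -> a < x -> x <= 1 ->
  exists2 c, a < c < x & f x - f a = f' c * (x - a).
Proof.
move=> a0 ax x1.
have [||c] := @MVT R f f' a x ax.
- move=> y; rewrite in_itv/= => /andP[ay yx]; apply: is_derive_interior.
  by rewrite (le_lt_trans a0 ay) (lt_le_trans yx x1).
- apply: continuous_subspaceW integrand_continuous => y /=.
  by rewrite !in_itv/= => /andP[ay yx]; rewrite (le_trans a0 ay) (le_trans yx x1).
by rewrite in_itv => cax E; exists c.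
Qed.

Lemma integrand_lipschitz (a x : R) : 0 <= a -> a <= x -> x <= 1 ->
  `|f x - f a| <= deriv_bound * (x - a).
Proof.
move=> a0; rewrite le_eqVlt => /predU1P[->|ax x1]; first by rewrite !subrr normr0 mulr0.
have [c /andP[ac cx] ->] := integrand_mean_value a0 ax x1.
rewrite normrM [X in _ * X]ger0_norm ?subr_ge0 ?(ltW ax)// ler_wpM2r ?subr_ge0 ?(ltW ax)//.
by apply: deriv_norm_le; lra.
Qed.

(** The mean value theorem turns the increment into [f' c * (x - a)] for some [c]
    within distance [l] of [a], where [f'] is close to [f' a]. *)
Lemma integrand_affine (a x l : R) : 0 <= a -> a <= x -> x <= 1 -> x - a <= l ->
  `|f x - f a - f' a * (x - a)| <= C * l `^ beta * l.
Proof.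
move=> a0 + x1 xl; rewrite le_eqVlt => /predU1P[ax|ax].
  rewrite ax !subrr mulr0 subr0 normr0 !mulr_ge0 ?powR_ge0//.
  by rewrite ax subrr in xl.
have [c /andP[ac cx] ->] := integrand_mean_value a0 ax x1.
rewrite -mulrBl normrM ler_pM//.
  by apply: deriv_close; [lra|lra|rewrite ger0_norm; lra].
by rewrite ger0_norm ?subr_ge0 ?(ltW ax).
Qed.

Definition cut (h : R -> R) : R -> R := h \_ `[0, 1].

Lemma cutE h x : 0 <= x <= 1 -> cut h x = h x.
Proof. by move=> x01; rewrite /cut patchE mem_set//= in_itv. Qed.

Lemma bounded_rv_cut (h : R -> R) (M : R) : 0 <= M ->
  {within `[0, 1], continuous h} -> (forall x, 0 <= x <= 1 -> `|h x| <= M) ->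
  bounded_rv (cut h).
Proof.
move=> M0 ch hM; split.
  apply/(measurable_restrictT _ _).1 => //.
  exact: subspace_continuous_measurable_fun.
exists M => x; rewrite /cut patchE; case: ifPn; last by rewrite normr0.
by rewrite inE/= in_itv; exact: hM.
Qed.

Lemma bounded_rv_cut_integrand : bounded_rv (cut f).
Proof.
apply: (@bounded_rv_cut _ (`|f 0| + deriv_bound)).
- by rewrite addr_ge0// deriv_bound_ge0.
- exact: integrand_continuous.
move=> x /andP[x0 x1]; have := integrand_lipschitz (lexx 0) x0 x1; rewrite subr0.
have := ler_normD (f x - f 0) (f 0); rewrite subrK => h1 h2.
apply: (le_trans h1); rewrite addrC lerD2l (le_trans h2)// ler_piMr//.
exact: deriv_bound_ge0.
Qed.

Lemma deriv_continuous : {within `[0, 1], continuous f'}.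
Proof.
have /andP[b0 b1] := hbeta.
apply/subspace_continuousP => x Ax.
apply/cvgrPdist_le => e e0; rewrite near_withinE.
have m0 : 0 < (e / (C + 1)) `^ beta^-1 by rewrite powR_gt0// divr_gt0// ltr_wpDl.
exists ((e / (C + 1)) `^ beta^-1) => //= y; rewrite /ball/= => yx Ay.
apply: (le_trans (hholder Ax Ay)).
apply: (@le_trans _ _ ((C + 1) * (e / (C + 1)))); last first.
  by rewrite mulrC divfK// gt_eqF// ltr_wpDl.
rewrite ler_pM ?powR_ge0// ?lerDl//.
have -> : e / (C + 1) = ((e / (C + 1)) `^ beta^-1) `^ beta.
  rewrite -powRrM mulVf ?gt_eqF// powRr1//.
  by rewrite divr_ge0 ?(ltW e0)// addr_ge0.
by rewrite ge0_ler_powR ?nnegrE ?powR_ge0 ?(ltW b0)// ltW.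
Qed.

Lemma bounded_rv_cut_deriv : bounded_rv (cut f').
Proof.
exact: (bounded_rv_cut deriv_bound_ge0 deriv_continuous deriv_norm_le).
Qed.

End smooth_integrand.

(** * The integrand on one stratum *)
Section stratum.
Context {R : realType} (f f' : R -> R) (beta C : R).
Hypothesis hbeta : 0 < beta <= 1.
Hypothesis hC : 0 <= C.
Hypothesis hderiv : has_derivative_on `[0, 1] f f'.
Hypothesis hholder : holder_on `[0, 1] f' C beta.
Context d (T : measurableType d) (P : probability T R).
Context (X : {RV P >-> R}) (a b : R).
Hypothesis unifX : uniformly_distributed P X a b.
Hypothesis a0 : 0 <= a.
Hypothesis b1 : b <= 1.

Local Notation M := (deriv_bound f' C).
Local Notation l := (b - a).
Local Notation g := (cut f).

Let ab : a < b. Proof. by case: unifX. Qed.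

Let M0 : 0 <= M. Proof. exact: (deriv_bound_ge0 f' hC). Qed.

Let bg : bounded_rv g.
Proof. exact: (bounded_rv_cut_integrand hbeta hC hderiv hholder). Qed.

Let lbeta : 0 <= l `^ beta <= 1.
Proof.
rewrite powR_ge0 (powR_le1 hbeta)// subr_ge0 (ltW ab)/=.
by move: ab a0 b1; lra.
Qed.

Definition stratum_mean : R := \int[P]_w g (X w).
Local Notation mu := stratum_mean.

(** The constant [f' a * ((b - a) / 2)] recentres the affine approximation at the
    midpoint, so that its random part has zero mean. *)
Let remainder (x : R) :=
  g x - (f a + f' a * ((b - a) / 2)) - f' a * centered_id a b x.

Let bounded_rv_remainder : bounded_rv remainder.
Proof.
apply: bounded_rvB; first by apply: bounded_rvB => //; exact: (bounded_rv_cst R).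
by apply: bounded_rvZ; exact: (bounded_rv_centered_id unifX).
Qed.

Let remainder_le x : a <= x <= b -> `|remainder x| <= C * l `^ beta * l.
Proof.
move=> xab; have /andP[ax xb] := xab.
rewrite /remainder centered_idE// cutE; last first.
  by rewrite (le_trans a0 ax) (le_trans xb b1).
have -> : f x - (f a + f' a * ((b - a) / 2)) - f' a * (x - (a + b) / 2)
    = f x - f a - f' a * (x - a) by field.
apply: (integrand_affine hbeta hC hderiv hholder) => //; first exact: le_trans b1.
by rewrite lerD2r.
Qed.

Let mu_remainder :
  mu = f a + f' a * ((b - a) / 2) + \int[P]_w remainder (X w).
Proof.
pose k := f a + f' a * ((b - a) / 2).
have b1' : bounded_rv (fun w => remainder (X w)) by exact: bounded_rv_comp.
have b2 : bounded_rv (fun w => f' a * centered_id a b (X w)).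
  apply: bounded_rvZ; apply: (@bounded_rv_comp _ _ _ _ X) => //.
  exact: (bounded_rv_centered_id unifX).
have b3 : bounded_rv (cst k : T -> R) by exact: bounded_rv_cst.
have -> : mu = \int[P]_w (cst k w + (f' a * centered_id a b (X w) + remainder (X w))).
  by apply: eq_Rintegral => w _; rewrite /k /remainder /=; ring.
rewrite expectD//; last exact: bounded_rvD.
rewrite [X in X + _](expect_cst P) expectD// expectZ; last first.
  by apply: (@bounded_rv_comp _ _ _ _ X) => //; exact: (bounded_rv_centered_id unifX).
by rewrite (expect_centered_id1 unifX) mulr0 add0r.
Qed.

Lemma stratum_deviation_affine x : a <= x <= b ->
  `|g x - mu - f' a * centered_id a b x| <= 2 * (C * l `^ beta * l).
Proof.
move=> xab; rewrite mu_remainder.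
have -> : g x - (f a + f' a * ((b - a) / 2) + \int[P]_w remainder (X w)) -
    f' a * centered_id a b x = remainder x - \int[P]_w remainder (X w).
  by rewrite /remainder; ring.
apply: (le_trans (ler_normB _ _)); rewrite mulr_natl mulr2n lerD//.
  exact: remainder_le.
exact: (expect_uniform_norm_le unifX bounded_rv_remainder remainder_le).
Qed.

Lemma stratum_deviation_le x : a <= x <= b -> `|g x - mu| <= 2 * M * l.
Proof.
have bc (c : R) : bounded_rv (cst c : R -> R) by exact: (bounded_rv_cst R).
have H y : a <= y <= b -> `|g y - f a| <= M * l.
  move=> /andP[ay yb]; rewrite cutE; last first.
    by rewrite (le_trans a0 ay) (le_trans yb b1).
  apply: (le_trans (integrand_lipschitz hbeta hC hderiv hholder a0 ay (le_trans yb b1))).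
  by rewrite ler_wpM2l// lerD2r.
move=> xab.
have -> : g x - mu = (g x - f a) - (mu - f a) by ring.
apply: (le_trans (ler_normB _ _)); rewrite -mulrA mulr_natl mulr2n lerD//.
  exact: H.
have -> : mu - f a = \int[P]_w (g (X w) - f a).
  rewrite expectB ?expect_cst//; first exact: (@bounded_rv_comp _ _ _ _ X).
  exact: bounded_rv_cst.
exact: (expect_uniform_norm_le unifX (bounded_rvB bg (bc (f a))) H).
Qed.

Let bdev : bounded_rv (fun x => g x - mu).
Proof. by apply: bounded_rvB => //; exact: (bounded_rv_cst R). Qed.

Lemma stratum_centered : \int[P]_w (g (X w) - mu) = 0.
Proof.
rewrite expectB ?expect_cst ?subrr//; first exact: (@bounded_rv_comp _ _ _ _ X).
exact: bounded_rv_cst.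
Qed.

(** Both deviations are of size [l] and their difference is of size
    [l `^ beta * l], so their squares differ by the product of the two
    orders; the affine part contributes exactly the variance of a uniform
    variable. *)
Lemma stratum_variance :
  `|\int[P]_w (g (X w) - mu) ^+ 2 - f' a ^+ 2 * l ^+ 2 / 12|
  <= 4 * C * (C + M) * l `^ beta * l ^+ 2.
Proof.
have bcid := bounded_rv_centered_id unifX.
have b2 : bounded_rv (fun x => (f' a * centered_id a b x) ^+ 2).
  by apply: (@bounded_rvX _ _ _ _ 2); exact: bounded_rvZ.
have b3 : bounded_rv (fun x => (g x - mu) ^+ 2) by exact: (@bounded_rvX _ _ _ _ 2).
have -> : \int[P]_w (g (X w) - mu) ^+ 2 - f' a ^+ 2 * l ^+ 2 / 12 =
    \int[P]_w ((g (X w) - mu) ^+ 2 - (f' a * centered_id a b (X w)) ^+ 2).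
  rewrite expectB; [|exact: (bounded_rv_comp _ b3)|exact: (bounded_rv_comp _ b2)].
  under [X in _ = _ - X]eq_Rintegral do rewrite exprMn.
  rewrite expectZ; last first.
    by apply: (@bounded_rvX _ _ _ _ 2); exact: bounded_rv_comp.
  by rewrite (expect_centered_id2 unifX) mulrA.
apply: (expect_uniform_norm_le unifX (bounded_rvB b3 b2)) => x xab.
rewrite subr_sqr normrM.
have h1 := stratum_deviation_affine xab.
have l0 : 0 <= l by rewrite subr_ge0 ltW.
have h2 : `|g x - mu + f' a * centered_id a b x| <= 2 * (C * l) + 2 * (M * l).
  have -> : g x - mu + f' a * centered_id a b x =
      (g x - mu - f' a * centered_id a b x) + 2 * (f' a * centered_id a b x) by ring.
  apply: (le_trans (ler_normD _ _)); apply: lerD.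
    apply: (le_trans h1); rewrite ler_pM2l// ler_wpM2r//.
    by case/andP: lbeta => _ ?; rewrite ler_piMr.
  rewrite normrM gtr0_norm// ler_pM2l// normrM ler_pM//.
    apply: (deriv_norm_le hbeta hC hholder).
    by rewrite a0 (le_trans (ltW ab) b1).
  exact: centered_id_norm_le.
apply: (le_trans (ler_pM _ _ h1 h2)) => //.
by rewrite le_eqVlt; apply/orP; left; apply/eqP; ring.
Qed.

(** The factor [s] is the normalization [sqrt N], and [q] the resulting bound on
    one summand. *)
Lemma stratum_moments_le (s : R) (q : R) : 0 <= s ->
  s * (2 * M * l) <= q ->
  (\int[P]_w `|s * (g (X w) - mu)| ^+ 3 <= q ^+ 3) /\
  (0 <= \int[P]_w (s * (g (X w) - mu)) ^+ 2 <= q ^+ 2).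
Proof.
move=> s0 sq.
have bs : bounded_rv (fun x => s * (g x - mu)) by exact: bounded_rvZ.
have H x : a <= x <= b -> `|s * (g x - mu)| <= q.
  move=> xab; rewrite normrM ger0_norm//.
  by apply: le_trans sq; rewrite ler_wpM2l// stratum_deviation_le.
split.
  apply: (le_trans (ler_norm _)).
  apply: (expect_uniform_norm_le unifX (bounded_rvX 3 (bounded_rv_norm bs))) => x xab.
  by rewrite normrX normr_id lerXn2r ?nnegrE// ?H// (le_trans _ (H _ xab)).
apply/andP; split; first by apply: Rintegral_ge0 => w _; exact: sqr_ge0.
apply: (le_trans (ler_norm _)).
apply: (expect_uniform_norm_le unifX (bounded_rvX 2 bs)) => x xab.
by rewrite normrX lerXn2r ?nnegrE// ?H// (le_trans _ (H _ xab)).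
Qed.

(** The error of the left-endpoint Riemann sum for the integral of the squared
    derivative, scaled to be compared with [stratum_variance]. *)
Lemma stratum_riemann :
  `|l * \int[lebesgue_measure]_(x in `[a, b]) cut f' x ^+ 2 - f' a ^+ 2 * l ^+ 2|
  <= 2 * M * C * l `^ beta * l ^+ 2.
Proof.
have bf2 : bounded_rv (fun x => cut f' x ^+ 2).
  by apply: (@bounded_rvX _ _ _ _ 2); exact: (bounded_rv_cut_deriv hbeta hC hholder).
have bc (c : R) : bounded_rv (cst c : R -> R) by exact: (bounded_rv_cst R).
have l0 : 0 < l by rewrite subr_gt0.
have a01 : 0 <= a <= 1 by rewrite a0 (le_trans (ltW ab) b1).
have -> : l * \int[lebesgue_measure]_(x in `[a, b]) cut f' x ^+ 2 =
    l ^+ 2 * \int[P]_w cut f' (X w) ^+ 2.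
  by rewrite (expect_uniform unifX bf2); field; rewrite gt_eqF.
have -> : l ^+ 2 * \int[P]_w cut f' (X w) ^+ 2 - f' a ^+ 2 * l ^+ 2 =
    l ^+ 2 * \int[P]_w (cut f' (X w) ^+ 2 - f' a ^+ 2).
  rewrite expectB ?expect_cst; first by ring.
    exact: (bounded_rv_comp _ bf2).
  exact: bounded_rv_cst.
rewrite normrM ger0_norm ?sqr_ge0// mulrC ler_wpM2r ?sqr_ge0//.
apply: (expect_uniform_norm_le unifX (bounded_rvB bf2 (bc (f' a ^+ 2)))) => x xab.
have x01 : 0 <= x <= 1 by move: a0 b1 xab; lra.
rewrite /= cutE// subr_sqr normrM mulrC -mulrA ler_pM//.
  apply: (le_trans (ler_normD _ _)); rewrite mulr_natl mulr2n.
  by rewrite lerD// (deriv_norm_le hbeta hC hholder).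
apply: (deriv_close hbeta hC hholder) => //.
by rewrite ger0_norm; move: xab; lra.
Qed.

Lemma stratum_variance_integral :
  `|\int[P]_w (g (X w) - mu) ^+ 2
    - 12^-1 * (l * \int[lebesgue_measure]_(x in `[a, b]) cut f' x ^+ 2)|
  <= 5 * C * (C + M) * l `^ beta * l ^+ 2.
Proof.
have := stratum_variance; have := stratum_riemann.
move: (\int[P]_w _) (l * \int[_]_(x in _) _) (f' a ^+ 2 * l ^+ 2) => u v w.
have k0 : 0 <= C * l `^ beta * l ^+ 2.
  by rewrite mulr_ge0 ?sqr_ge0// mulr_ge0//; case/andP: lbeta.
have -> : 2 * M * C * l `^ beta * l ^+ 2 = 2 * (M * (C * l `^ beta * l ^+ 2)) by ring.
have -> : 4 * C * (C + M) * l `^ beta * l ^+ 2 =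
  4 * (M * (C * l `^ beta * l ^+ 2) + C * (C * l `^ beta * l ^+ 2)) by ring.
have -> : 5 * C * (C + M) * l `^ beta * l ^+ 2 =
  5 * (M * (C * l `^ beta * l ^+ 2) + C * (C * l `^ beta * l ^+ 2)) by ring.
have p0 := mulr_ge0 M0 k0; have q0 := mulr_ge0 hC k0.
move: (M * _) (C * (C * _ * _)) p0 q0 => p q p0 q0.
by rewrite !ler_norml; lra.
Qed.

End stratum.

(** * The stratified estimator *)
Section stratified_sum.
Context {R : realType}.
Local Notation leb := (@lebesgue_measure R).

Lemma sum_stratum_integrals (h : R -> R) (n : nat) : bounded_rv h -> (0 < n)%N ->
  \sum_(i < n) \int[leb]_(x in `[i%:R / n%:R, i.+1%:R / n%:R]) h x
  = \int[leb]_(x in `[0, 1]) h x.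
Proof.
move=> bh n0; have n0R : 0 < n%:R :> R by rewrite ltr0n.
suff H k : \sum_(i < k) \int[leb]_(x in `[i%:R / n%:R, i.+1%:R / n%:R]) h x
    = \int[leb]_(x in `[0, k%:R / n%:R]) h x.
  by rewrite H divff// gt_eqF.
elim: k => [|k IH].
  by rewrite big_ord0 mul0r set_itv1 Rintegral_set1.
rewrite big_ord_recr /= IH -[X in _ + X]Rintegral_itv_obnd_cbnd; last first.
  apply: integrableS (bounded_rv_integrable_itv (k%:R / n%:R) (k.+1%:R / n%:R) bh) => //.
  by move=> x /=; rewrite !in_itv/= => /andP[/ltW ->].
rewrite -(@Rintegral_itvB _ h (BLeft 0) (BRight (k.+1%:R / n%:R))).
- by rewrite addrC subrK.
- exact: bounded_rv_integrable_itv.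
- by rewrite bnd_simp divr_ge0.
- by rewrite bnd_simp ler_pM2r ?invr_gt0// ler_nat.
Qed.

Context (f f' : R -> R) (beta C : R).
Hypothesis hbeta : 0 < beta <= 1.
Hypothesis hC : 0 <= C.
Hypothesis hderiv : has_derivative_on `[0, 1] f f'.
Hypothesis hholder : holder_on `[0, 1] f' C beta.
Context d (T : measurableType d) (P : probability T R).
Context (n : nat) (X : 'I_n -> {RV P >-> R}).
Hypothesis n0 : (0 < n)%N.
Hypothesis unifX : forall i : 'I_n,
  uniformly_distributed P (X i) (i%:R / n%:R) (i.+1%:R / n%:R).

Local Notation M := (deriv_bound f' C).

Definition normalized_deviation (i : 'I_n) (x : R) : R :=
  Num.sqrt n%:R * (cut f x - stratum_mean f (X i)).
Local Notation dev := normalized_deviation.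

Let nR : 0 < n%:R :> R. Proof. by rewrite ltr0n. Qed.

Let lE (i : 'I_n) : i.+1%:R / n%:R - i%:R / n%:R = n%:R^-1 :> R.
Proof. by rewrite -mulrBl -natrB// subSnn mul1r. Qed.

Let lft (i : 'I_n) : 0 <= i%:R / n%:R :> R. Proof. by rewrite divr_ge0. Qed.

Let rgt (i : 'I_n) : i.+1%:R / n%:R <= 1 :> R.
Proof. by rewrite ler_pdivrMr// mul1r ler_nat. Qed.

Let bcut : bounded_rv (cut f).
Proof. exact: (bounded_rv_cut_integrand hbeta hC hderiv hholder). Qed.

Lemma bounded_rv_normalized_deviation i : bounded_rv (dev i).
Proof. by apply: bounded_rvZ; apply: bounded_rvB => //; exact: (bounded_rv_cst R). Qed.

Lemma expect_normalized_deviation i : \int[P]_w dev i (X i w) = 0.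
Proof.
rewrite expectZ; last first.
  apply: bounded_rvB; last exact: bounded_rv_cst.
  exact: (@bounded_rv_comp _ _ _ _ (X i)).
by rewrite (stratum_centered hbeta hC hderiv hholder (X i)) mulr0.
Qed.

(** The strata have equal length, so the means over them average to the
    integral. *)
Lemma sum_normalized_deviation w :
  \sum_(i < n) dev i (X i w) =
  n%:R * Num.sqrt n%:R * (quadrature f (fun i => X i : T -> R) w - integral01 f).
Proof.
rewrite -mulr_sumr sumrB [n%:R * _]mulrC -mulrA; congr (_ * _).
rewrite mulrBr mulrA divff ?gt_eqF// mul1r; congr (_ - _).
have -> : integral01 f = \int[leb]_(x in `[0, 1]) cut f x.
  by apply: eq_Rintegral => x; rewrite inE/= in_itv/= => x01; rewrite cutE.
rewrite -(sum_stratum_integrals bcut n0) mulr_sumr; apply: eq_bigr => i _.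
by rewrite /stratum_mean (expect_uniform (unifX i) bcut) lE invrK.
Qed.

(** Summing [stratum_variance_integral] over [n] strata multiplies its error,
    of order [n ^ (- 1 - beta)] after normalization, by [n]. *)
Lemma sum_variance_sigma2 :
  `|\sum_(i < n) \int[P]_w dev i (X i w) ^+ 2 - sigma2 f'|
  <= 5 * C * (C + M) * n%:R^-1 `^ beta.
Proof.
have bf2 : bounded_rv (fun x => cut f' x ^+ 2).
  by apply: (@bounded_rvX _ _ _ _ 2); exact: (bounded_rv_cut_deriv hbeta hC hholder).
have -> : sigma2 f' = \sum_(i < n) 12^-1 *
    \int[leb]_(x in `[i%:R / n%:R, i.+1%:R / n%:R]) cut f' x ^+ 2.
  rewrite -mulr_sumr (sum_stratum_integrals bf2 n0) /sigma2 /integral01.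
  by congr (_ * _); apply: eq_Rintegral => x; rewrite inE/= in_itv/= => x01; rewrite cutE.
rewrite -sumrB; apply: (le_trans (ler_norm_sum _ _ _)).
set K := 5 * C * (C + M) * n%:R^-1 `^ beta.
have -> : K = \sum_(i < n) K * n%:R^-1.
  by rewrite sumr_const card_ord -[_ *+ _]mulr_natr divfK// gt_eqF.
apply: ler_sum => i _.
have bdev2 : bounded_rv (fun w => (cut f (X i w) - stratum_mean f (X i)) ^+ 2).
  apply: (@bounded_rvX _ _ _ _ 2); apply: bounded_rvB; last exact: bounded_rv_cst.
  exact: (@bounded_rv_comp _ _ _ _ (X i)).
have := stratum_variance_integral hbeta hC hderiv hholder (unifX i) (lft i) (rgt i).
rewrite lE -/K; move: (\int[leb]_(x in _) _) => J H.
have -> : \int[P]_w dev i (X i w) ^+ 2 =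
    n%:R * \int[P]_w (cut f (X i w) - stratum_mean f (X i)) ^+ 2.
  rewrite -expectZ//; apply: eq_Rintegral => w _.
  by rewrite /dev exprMn sqr_sqrtr// ltW.
have -> : n%:R * \int[P]_w (cut f (X i w) - stratum_mean f (X i)) ^+ 2 - 12^-1 * J
  = n%:R * (\int[P]_w (cut f (X i w) - stratum_mean f (X i)) ^+ 2 - 12^-1 * (n%:R^-1 * J)).
  by field; rewrite gt_eqF.
rewrite normrM gtr0_norm// -ler_pdivlMl//.
by apply: (le_trans H); rewrite expr2 mulrCA mulrA mulrAC.
Qed.

(** Each summand is bounded by [q = 2 * M / sqrt n], and [n * q ^+ 2] does not
    depend on [n]. *)
Lemma sum_lyapunov_le :
  0 <= \sum_(i < n) (\int[P]_w `|dev i (X i w)| ^+ 3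
                + (\int[P]_w dev i (X i w) ^+ 2) ^+ 2)
  <= (2 * M) ^+ 2 * (2 * M / Num.sqrt n%:R + (2 * M / Num.sqrt n%:R) ^+ 2).
Proof.
apply/andP; split.
  apply: sumr_ge0 => i _; rewrite addr_ge0 ?sqr_ge0//.
  by apply: Rintegral_ge0 => w _; rewrite exprn_ge0.
have s0 : 0 < Num.sqrt n%:R :> R by rewrite sqrtr_gt0.
have sE : Num.sqrt n%:R ^+ 2 = n%:R :> R by rewrite sqr_sqrtr// ltW.
set q := 2 * M / Num.sqrt n%:R.
have -> : (2 * M) ^+ 2 * (q + q ^+ 2) = \sum_(i < n) (q ^+ 3 + (q ^+ 2) ^+ 2).
  rewrite sumr_const card_ord -[RHS]mulr_natl -[X in _ = X * _]sE /q; field.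
  by rewrite gt_eqF.
apply: ler_sum => i _.
have sq : Num.sqrt n%:R * (2 * M * (i.+1%:R / n%:R - i%:R / n%:R)) <= q.
  rewrite lE /q le_eqVlt; apply/orP; left; apply/eqP.
  by rewrite -[X in _ * (2 * M / X) = _]sE; field; rewrite gt_eqF.
have [h1 /andP[h2 h3]] := stratum_moments_le hbeta hC hderiv hholder (unifX i)
  (lft i) (rgt i) (ltW s0) sq.
by rewrite lerD// lerXn2r ?nnegrE// (le_trans h2 h3).
Qed.

End stratified_sum.

Lemma cvg_invr_expn (R : realType) (b : nat) : (2 <= b)%N ->
  ((b ^ m)%:R^-1 : R) @[m --> \oo] --> (0 : R).
Proof.
move=> hb; have b1 : `|(b%:R^-1 : R)| < 1.
  have b0 : 1 < b%:R :> R by rewrite ltr1n.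
  by rewrite ger0_norm ?invr_ge0// invf_lt1// (lt_trans _ b0).
have := cvg_expr b1; apply: cvg_trans.
apply: near_eq_cvg; near=> m; by rewrite natrX exprVn.
Unshelve. all: by end_near. Qed.

Lemma natr_powR_three_halves (R : realType) (n : nat) : (0 < n)%N ->
  n%:R `^ (3 / 2) = n%:R * Num.sqrt n%:R :> R.
Proof.
move=> n0; have -> : 3 / 2 = 1 + 2^-1 :> R by field.
rewrite powRD; first by rewrite powRr1// powR12_sqrt.
by rewrite pnatr_eq0 gt_eqF// implybT.
Qed.

Lemma quadrature_clt (R : realType) (b : nat) (f f' : R -> R) (beta C y : R)
    (d : nat -> measure_display) (T : forall m, measurableType (d m))
    (P : forall m, probability (T m) R)
    (X : forall m, 'I_(b ^ m) -> {RV (P m) >-> R}) :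
  (2 <= b)%N -> 0 < beta <= 1 -> 0 <= C ->
  has_derivative_on `[0, 1] f f' -> holder_on `[0, 1] f' C beta ->
  (forall m, mutually_independent (P m) (X m)) ->
  (forall m (i : 'I_(b ^ m)),
     uniformly_distributed (P m) (X m i)
       (i%:R / (b ^ m)%:R) (i.+1%:R / (b ^ m)%:R)) ->
  sigma2 f' != 0 \/ y != 0 ->
  fine (P m [set w | (b ^ m)%:R `^ (3 / 2) *
     (quadrature f (fun i => X m i : T m -> R) w - integral01 f) <= y])
   @[m --> \oo] --> normal_cdf (sigma2 f') y.
Proof.
move=> hb hbeta hC hderiv hholder hXindep hXunif h.
have n0 m : (0 < b ^ m)%N by rewrite expn_gt0 (ltnW hb).
have inv0 := @cvg_invr_expn R b hb.
have := @lyapunov_clt_indep _ _ _ P (fun m => (b ^ m)%N) X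
  (fun m => normalized_deviation f (X m)) (sigma2 f') y hXindep.
move=> /(_ (fun m i => bounded_rv_normalized_deviation hbeta hC hderiv hholder (X m) i)).
move=> /(_ (fun m i => expect_normalized_deviation hbeta hC hderiv hholder (X m) i)).
move=> /= H; have := H _ _ h => {H} H.
have -> : (fun m => fine (P m [set w | (b ^ m)%:R `^ (3 / 2) *
     (quadrature f (fun i => X m i : T m -> R) w - integral01 f) <= y])) =
  fun m => fine (P m [set w | \sum_(i < b ^ m) normalized_deviation f (X m) i (X m i w) <= y]).
  apply/funext => m; congr (fine (P m _)); apply/funext => w /=.
  by rewrite (sum_normalized_deviation hbeta hC hderiv hholder (n0 m) (@hXunif m))
     natr_powR_three_halves.
apply: H.
- apply/cvgrPdist_le => e e0.
  set K := 5 * C * (C + deriv_bound f' C).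
  have K0 : 0 <= K by rewrite !mulr_ge0 ?addr_ge0.
  have cK : K * (b ^ m)%:R^-1 `^ beta @[m --> \oo] --> (0 : R).
    rewrite -[X in _ --> X](mulr0 K); apply: cvgMl_tmp.
    have b0 : 0 < beta by case/andP: hbeta.
    apply/cvgrPdist_lt => e' e'0.
    have p0 : 0 < e' `^ beta^-1 by rewrite powR_gt0.
    move/cvgrPdist_lt : inv0 => /(_ _ p0); apply: filterS => m.
    rewrite !sub0r !normrN !ger0_norm ?powR_ge0// => hm.
    have -> : e' = (e' `^ beta^-1) `^ beta.
      by rewrite -powRrM mulVf ?gt_eqF// powRr1// ltW.
    by rewrite gt0_ltr_powR// nnegrE ?powR_ge0.
  move/cvgrPdist_le : cK => /(_ _ e0); apply: filterS => m.
  rewrite sub0r normrN ger0_norm ?(mulr_ge0 K0) ?powR_ge0// => hm.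
  rewrite distrC (le_trans _ hm)//.
  exact: (sum_variance_sigma2 hbeta hC hderiv hholder (n0 m) (@hXunif m)).
- set D := 2 * deriv_bound f' C.
  have cs : D / Num.sqrt (b ^ m)%:R @[m --> \oo] --> (0 : R).
    rewrite -[X in _ --> X](mulr0 D); apply: cvgMl_tmp.
    have -> : (fun m => (Num.sqrt (b ^ m)%:R)^-1) = fun m => Num.sqrt ((b ^ m)%:R^-1) :> R.
      by apply/funext => m; rewrite sqrtrV.
    by rewrite -[X in _ --> X]sqrtr0; exact: cvg_sqrt.
  have cD : D ^+ 2 * (D / Num.sqrt (b ^ m)%:R + (D / Num.sqrt (b ^ m)%:R) ^+ 2)
      @[m --> \oo] --> (0 : R).
    rewrite -[X in _ --> X](mulr0 (D ^+ 2)); apply: cvgMl_tmp.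
    rewrite -[X in _ --> X](addr0 0); apply: cvgD => //.
    by rewrite -[X in _ --> X](mulr0 0); exact: cvgM.
  apply: (squeeze_cvgr _ (cvg_cst 0) cD); apply: nearW => m.
  exact: (sum_lyapunov_le hbeta hC hderiv hholder (n0 m) (@hXunif m)).
Qed.

(** * Rescaled medians and their limit laws *)
Section limit_laws.
Context {R : realType}.

Lemma mutually_independent_rescaled d (T : measurableType d) (P : probability T R)
    (I : finType) (X : I -> {RV P >-> R}) (a c : R) :
  mutually_independent P X ->
  mutually_independent P (fun i => rescaled_rv a c (X i) : {RV P >-> R}).
Proof.
move=> iX J A mA; have mg : measurable_fun setT (fun y : R => a * (y - c)).
  by apply: measurable_funM => //; exact: measurable_funB.
apply: (iX J (fun i => (fun y => a * (y - c)) @^-1` A i)) => i.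
exact: measurable_preimage.
Qed.

Lemma median_rv_rescaled d (T : measurableType d) (r : nat)
    (X : 'I_r -> {mfun T >-> R}) (a c : R) w : 0 < a -> (0 < r)%N ->
  median_rv (fun i => rescaled_rv a c (X i) : {mfun T >-> R}) w
  = rescaled_rv a c (median_rv X) w.
Proof.
move=> a0 r0; rewrite /rescaled_rv/= /median_rv -median_affine//; last first.
  by rewrite size_map size_enum_ord.
by congr median; rewrite -[RHS]map_comp.
Qed.

(** Multiplying the copies by [sqrt r] multiplies the limit variance by [r]. *)
Lemma normal_cdf_scale (s2 c y : R) : 0 < c ->
  normal_cdf s2 (y / Num.sqrt c) = normal_cdf (c * s2) y.
Proof.
move=> c0; rewrite /normal_cdf mulf_eq0 (gt_eqF c0)/=; case: ifPn => _.
  by rewrite pmulr_lge0// invr_gt0 sqrtr_gt0.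
by rewrite sqrtrM ?ltW// invfM mulrA.
Qed.

(** The case of zero variance.  Each copy lies almost surely on the same side of
    [x] as 0, hence by independence all of them do, and so does their median. *)
Lemma median_point_mass d (T : measurableType d) (P : probability T R) (r : nat)
    (Z : 'I_r -> {RV P >-> R}) (x : R) : (0 < r)%N ->
  mutually_independent P Z ->
  (forall j y, cdf (Z j) y = (0 <= y)%R%:R%:E) ->
  P [set w | median_rv Z w <= x] = (0 <= x)%R%:R%:E.
Proof.
move=> r0 iZ cZ.
have mM : measurable [set w | median_rv Z w <= x].
  rewrite (_ : [set _ | _] = median_rv Z @^-1` `]-oo, x]); first exact: measurable_funPTI.
  by apply/seteqP; split => w /=; rewrite in_itv.
pose A : set R := if 0 <= x then `]-oo, x]%classic else `]x, +oo[%classic.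
have mA : measurable A by rewrite /A; case: ifP.
have mI j : measurable (Z j @^-1` `]-oo, x]) by exact: measurable_funPTI.
have PA j : P (Z j @^-1` A) = 1%E.
  have := cZ j x; rewrite /cdf /distribution /pushforward /A; case: ifPn => // _ H.
  rewrite -setCitvl preimage_setC probability_setC; first by rewrite H sube0.
  exact: mI.
pose B := \bigcap_(i in [set` [set: 'I_r]%SET]) Z i @^-1` A.
have PB : P B = 1%E.
  by rewrite /B (iZ [set: 'I_r]%SET (fun=> A))// big1// => j _; exact: PA.
have mB : measurable B.
  by apply: fin_bigcap_measurable => // i _; exact: measurable_funPTI.
have BZ w j : B w -> A (Z j w) by apply; rewrite /= finset.in_setT.
have sz w : size [seq Z i w | i <- enum 'I_r] = r by rewrite size_map size_enum_ord.
have [x0|x0] := leP 0 x.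
  apply/eqP; rewrite eq_le probability_le1//= -PB le_measure ?inE// => w Bw /=.
  apply: median_le_count; rewrite sz.
  rewrite (_ : count _ _ = r); first by rewrite mul2n -addnn -[X in (X < _)%N]addn0 ltn_add2l.
  apply/eqP; rewrite -[X in _ == X](sz w) -all_count; apply/allP => _ /mapP[j _ ->].
  by have := BZ w j Bw; rewrite /A x0 /= in_itv.
apply/eqP; rewrite eq_le measure_ge0 andbT.
rewrite [leRHS](_ : _ = P (~` B)); last by rewrite probability_setC// PB subee.
rewrite le_measure ?inE//; first exact: measurableC.
move=> w /= mx Bw; have := @count_median_le _ [seq Z j w | j <- enum 'I_r] x.
rewrite sz => /(_ r0 mx); rewrite leqNgt => /negP; apply.
rewrite (_ : count _ _ = 0%N)//; apply/eqP; rewrite -leqn0 leqNgt -has_count.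
apply/hasPn => _ /mapP[j _ ->].
by have := BZ w j Bw; rewrite /A leNgt x0 /= in_itv/= andbT -ltNge.
Qed.

Lemma cvg_cdf_fine (d : nat -> measure_display) (T : forall n, measurableType (d n))
    (P : forall n, probability (T n) R) (X : forall n, {RV (P n) >-> R}) (x l : R) :
  fine (cdf (X n) x) @[n --> \oo] --> l -> cdf (X n) x @[n --> \oo] --> l%:E.
Proof.
move=> H; apply: cvg_EFin => //.
by apply: nearW => n; exact: fin_num_measure.
Qed.

End limit_laws.

Theorem theorem2p1 (R : realType) (b : nat) (hb : (2 <= b)%N)
  (f f' : R -> R) (beta C : R)
  (hbeta : 0 < beta <= 1) (hC : 0 <= C)
  (hderiv : has_derivative_on `[0, 1] f f')
  (hholder : holder_on `[0, 1] f' C beta)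
  (* X m i is X_{N,i} for N = b ^ m *)
  (d : nat -> measure_display) (T : forall m, measurableType (d m))
  (P : forall m, probability (T m) R)
  (X : forall m, 'I_(b ^ m) -> {RV (P m) >-> R})
  (hXindep : forall m, mutually_independent (P m) (X m))
  (hXunif : forall m (i : 'I_(b ^ m)),
     uniformly_distributed (P m) (X m i)
       (i%:R / (b ^ m)%:R) (i.+1%:R / (b ^ m)%:R))
  (* Q r m j, for j < r, are r independent copies of Q_N for N = b ^ m *)
  (dQ : nat -> nat -> measure_display)
  (TQ : forall r m, measurableType (dQ r m))
  (PQ : forall r m, probability (TQ r m) R)
  (Q : forall r m, 'I_r -> {RV (PQ r m) >-> R})
  (hQindep : forall r m, mutually_independent (PQ r m) (Q r m))
  (hQlaw : forall r m (j : 'I_r) (A : set R), measurable A ->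
     distribution (PQ r m) (Q r m j) A
     = P m (quadrature f (fun i => X m i : T m -> R) @^-1` A)) :
  exists (dY : nat -> measure_display) (TY : forall r, measurableType (dY r))
    (PY : forall r, probability (TY r) R)
    (Y : forall r, {RV (PY r) >-> R}),
    (forall r, (0 < r)%N ->
       cvg_in_distribution (PQ r)
         (fun m => rescaled_rv (Num.sqrt r%:R * (b ^ m)%:R `^ (3 / 2))
                     (integral01 f) (median_rv (Q r m)))
         (distribution (PY r) (Y r)))
    /\ cvg_in_distribution PY Y (centered_normal (pi * sigma2 f' / 2)).
Proof.
(* Y r is the median of r independent normal variables of variance r * sigma2 f' *)
have s20 : 0 <= sigma2 f'.
  by rewrite mulr_ge0 ?invr_ge0//; apply: Rintegral_ge0 => x _; exact: sqr_ge0.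
have rs20 r : 0 <= r%:R * sigma2 f' by rewrite mulr_ge0.
pose EP r := cid (iid_family_exists (scaled_normal (r%:R * sigma2 f')) r).
pose E r : rv_family r := projT1 (EP r).
have iE r : mutually_independent (rv_prob (E r)) (rv_fun (E r)).
  by have [] := projT2 (EP r).
have cE r j y : cdf (rv_fun (E r) j) y = (normal_cdf (r%:R * sigma2 f') y)%:E.
  rewrite -cdf_scaled_normal// /cdf.
  by have [_ h] := projT2 (EP r); exact: h.
exists (fun r => rv_disp (E r)), (fun r => rv_space (E r)), (fun r => rv_prob (E r)),
  (fun r => median_rv (rv_fun (E r))).
have setE d1 (T1 : measurableType d1) (Z : T1 -> R) (x : R) :
    Z @^-1` `]-oo, x] = [set w | Z w <= x].
  by apply/seteqP; split => w /=; rewrite in_itv.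
split=> [r r0 x cx|x _]; last first.
  rewrite centered_normal_cdf; last by rewrite divr_ge0// mulr_ge0// pi_ge0.
  apply: cvg_cdf_fine; rewrite /cdf /distribution /pushforward.
  under eq_cvg do rewrite setE.
  have [s2z|s2n] := eqVneq (sigma2 f') 0; last first.
    apply: median_normal_cvg => //; first by rewrite lt_neqAle eq_sym s2n.
    by move=> r j y; rewrite cE.
  rewrite s2z mulr0 mul0r /normal_cdf eqxx.
  apply: (cvg_near_eq (cvg_cst _)); near=> r.
  rewrite (median_point_mass x _ (iE r))//; first by near: r; exact: nbhs_infty_gt.
  by move=> j y; rewrite cE s2z mulr0 /normal_cdf eqxx.
have sr0 : 0 < Num.sqrt r%:R :> R by rewrite sqrtr_gt0 ltr0n.
pose a m : R := Num.sqrt r%:R * (b ^ m)%:R `^ (3 / 2).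
have a0 m : 0 < a m.
  by rewrite mulr_gt0// powR_gt0// ltr0n expn_gt0 (ltnW hb).
pose Qs m (j : 'I_r) : {RV (PQ r m) >-> R} := rescaled_rv (a m) (integral01 f) (Q r m j).
rewrite [X in _ --> X](_ : _ =
    (fine (rv_prob (E r) [set w | median_rv (rv_fun (E r)) w <= x]))%:E); last first.
  rewrite fineK; last by apply: fin_num_measure; rewrite -setE; exact: measurable_funPTI.
  by rewrite /distribution /pushforward setE.
apply: cvg_cdf_fine.
have -> : (fun m => fine (@cdf _ _ _ (PQ r m)
      (rescaled_rv (a m) (integral01 f) (median_rv (Q r m))) x)) =
    fun m => fine (PQ r m [set w | median_rv (Qs m) w <= x]).
  apply/funext => m; rewrite /cdf /distribution /pushforward setE.
  by congr (fine (PQ r m _)); apply/seteqP; split => w /=; rewrite median_rv_rescaled.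
apply: median_rv_cvg => //.
- by move=> m; exact: mutually_independent_rescaled.
- move=> j y y0; rewrite cE /=.
  rewrite -normal_cdf_scale ?ltr0n//.
  have yr0 : y / Num.sqrt r%:R != 0 by rewrite mulf_neq0// invr_neq0// gt_eqF.
  have := quadrature_clt hb hbeta hC hderiv hholder hXindep hXunif (or_intror yr0).
  move/cvg_near_eq; apply; apply: nearW => m.
  pose B : set R := [set z | a m * (z - integral01 f) <= y].
  have mB : measurable B.
    rewrite /B -setE; apply: measurable_preimage => //.
    by apply: measurable_funM => //; exact: measurable_funB.
  rewrite /cdf /distribution /pushforward setE.
  transitivity (fine (distribution (PQ r m) (Q r m j) B)) => //.
  rewrite hQlaw//; congr (fine (P m _)); apply/funext => w; rewrite /B /=.
  by rewrite ler_pdivlMr// /a -[in RHS]mulrA [in RHS]mulrC.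
- rewrite (_ : (fun t => _) = fine \o (fun t : R =>
      distribution (rv_prob (E r)) (median_rv (rv_fun (E r))) `]-oo, t])).
    apply: fine_cvg; rewrite /= fineK//.
    by apply: fin_num_measure; exact: measurable_itv.
  by apply/funext => t /=; rewrite /distribution /pushforward setE.
Unshelve. all: by end_near. Qed.
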